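(* Let $G$ be a tree (finite or infinite) with maximum degree $\Delta\ge 3$ (where $\Delta$ may be an infinite cardinal). Then either $G$ is a symmetric tree, or $G$ is a bisymmetric tree, or $D'_l(G)\le \Delta-1$; that is, in the last case, for every assignment $\{L(e)\}_{e\in E(G)}$ of lists of colours with $|L(e)|=\Delta-1$ for every edge $e$, there exists a distinguishing edge colouring $c$ of $G$ with $c(e)\in L(e)$ for every $e\in E(G)$.
   Context: The maximum degree $\Delta$ of a (possibly infinite) graph is the supremum of its vertex degrees; if $\Delta$ is an infinite cardinal, $\Delta-1$ is understood as $\Delta$. An edge colouring $c$ of $G$ is distinguishing if the only automorphism of $G$ preserving $c$ (i.e. mapping every edge to an edge of the same colour) is the identity. The list distinguishing index $D'_l(G)$ is the minimum cardinal $k$ such that for every assignment of lists $L(e)$ of cardinality $k$ to the edges $e$ of $G$ there is a distinguishing edge colouring $c$ with $c(e)\in L(e)$ for all edges $e$. A symmetric tree is a finite tree with a central vertex $v_0$ such that all leaves are at the same distance from $v_0$ and all non-leaf vertices have the same degree. A bisymmetric tree is a finite tree with a central edge $e_0$ such that all leaves are at the same distance from $e_0$ and all non-leaf vertices have the same degree. *)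

(* Defs.v *)
(* Graphs and trees of arbitrary cardinality. Cardinals are represented by sets
   and compared with the relations #<= and #= of mathcomp.classical. *)
From HB Require Import structures.
From mathcomp Require Import all_boot all_order.
From mathcomp Require Import boolp classical_sets functions cardinality.

Set Implicit Arguments.
Unset Strict Implicit.
Unset Printing Implicit Defensive.

Local Open Scope classical_set_scope.
Local Open Scope card_scope.

Record sgraph := SGraph {
  vertex :> choiceType;
  adj : rel vertex;
  adj_sym : symmetric adj;
  adj_irr : irreflexive adj }.

Definition nbrs (G : sgraph) (v : G) : set G := [set u | adj v u].

Definition edges (G : sgraph) : set (set G) :=
  [set e | exists x y : G, adj x y /\ e = [set x; y]].
Arguments edges : clear implicits.

Definition connected_graph (G : sgraph) : Prop :=
  forall x y : G, exists2 p : seq G, path (@adj G) x p & last x p = y.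

(* A duplicate-free closed walk of size 2 only runs back and forth along an
   edge, so cycles of the graph have size at least 3. *)
Definition acyclic_graph (G : sgraph) : Prop :=
  ~ exists2 p : seq G, 2 < size p & ucycle (@adj G) p.

Definition is_tree (G : sgraph) : Prop :=
  connected_graph G /\ acyclic_graph G.

Definition is_max_degree (G : sgraph) (T : Type) (D : set T) : Prop :=
  (forall v : G, nbrs v #<= D) /\
  (forall (U : Type) (B : set U), (forall v : G, nbrs v #<= B) -> D #<= B).

(* |K| = |D| - 1, where |D| - 1 is |D| when D is infinite. *)
Definition card_pred (T : Type) (D : set T) (U : Type) (K : set U) : Prop :=
  (infinite_set D /\ K #= D) \/ (exists n : nat, D #= `I_n.+1 /\ K #= `I_n).

Definition is_dist (G : sgraph) (x y : G) (n : nat) : Prop :=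
  (exists p : seq G, [/\ path (@adj G) x p, last x p = y & size p = n]) /\
  (forall p : seq G, path (@adj G) x p -> last x p = y -> n <= size p).

(* The value is the junk 0 if x and y are not connected. *)
Definition dist (G : sgraph) (x y : G) : nat := xget 0 [set n | is_dist x y n].

Definition is_ecc (G : sgraph) (v : G) (n : nat) : Prop :=
  (exists w : G, dist v w = n) /\ (forall w : G, dist v w <= n).

Definition center (G : sgraph) : set G :=
  [set v | exists2 n, is_ecc v n & forall (u : G) m, is_ecc u m -> n <= m].
Arguments center : clear implicits.

Definition leaf (G : sgraph) (v : G) : Prop := nbrs v #= `I_1.

Definition inner_regular (G : sgraph) : Prop :=
  forall u v : G, ~ leaf u -> ~ leaf v -> nbrs u #= nbrs v.

(* The central vertex (edge) of a finite tree is its center, when the center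
   consists of one vertex (of two adjacent vertices). *)
Definition symmetric_tree (G : sgraph) : Prop :=
  [/\ finite_set [set: G], is_tree G, inner_regular G &
      exists v0 : G, center G = [set v0] /\
        forall u w : G, leaf u -> leaf w -> dist v0 u = dist v0 w].

Definition bisymmetric_tree (G : sgraph) : Prop :=
  [/\ finite_set [set: G], is_tree G, inner_regular G &
      exists x0 y0 : G, [/\ adj x0 y0, center G = [set x0; y0] &
        forall u w : G, leaf u -> leaf w ->
          minn (dist x0 u) (dist y0 u) = minn (dist x0 w) (dist y0 w)]].

Definition automorphism (G : sgraph) (f : G -> G) : Prop :=
  bijective f /\ (forall x y : G, adj (f x) (f y) = adj x y).

Definition preserves (G : sgraph) (C : Type) (c : edges G -> C) (f : G -> G)
  : Prop :=
  forall e e' : edges G, val e' = f @` val e -> c e' = c e.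

Definition distinguishing (G : sgraph) (C : Type) (c : edges G -> C) : Prop :=
  forall f : G -> G, automorphism f -> preserves c f -> forall x : G, f x = x.

Definition list_distinguishable (G : sgraph) (U : Type) (K : set U) : Prop :=
  forall (C : Type) (L : edges G -> set C), (forall e, L e #= K) ->
    exists c : edges G -> C, (forall e, L e (c e)) /\ distinguishing c.

(* D'_l(G) = |K| *)
Definition is_list_distinguishing_index (G : sgraph) (U : Type) (K : set U)
  : Prop :=
  list_distinguishable G K /\
  (forall (W : Type) (K' : set W), list_distinguishable G K' -> K #<= K').

(* Main.v *)
Require Import Defs.
From HB Require Import structures.
From mathcomp Require Import all_boot all_order.
From mathcomp Require Import boolp classical_sets functions cardinality.
From mathcomp Require Import wochoice.

Set Implicit Arguments.
Unset Strict Implicit.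
Unset Printing Implicit Defensive.

Local Open Scope classical_set_scope.
Local Open Scope card_scope.

(* Orient the tree towards a root, towards a central edge, or towards an end,
   so that a vertex other than the root has at most Delta - 1 child edges,
   which can then receive distinct colours from lists of size Delta - 1; a
   colour preserving automorphism that respects the orientation and fixes its
   root is trivial.

   If Delta is infinite, an edge is made recognisable by colours used nowhere
   else. If the tree is finite, automorphisms respect its center, and the
   obstacles are two equal colours at a central vertex of degree Delta and
   the exchange of the ends of a central edge. Both are overcome by making
   two coloured subtrees non-isomorphic, which is possible unless the
   subtrees are full (Delta - 1)-ary trees of the same height, that is,
   unless the tree is (bi)symmetric. If the tree is infinite and Delta is
   finite, it contains a ray v 0, v 1, ...; orient it towards the end of this
   ray. Since the child edges of a vertex have distinct colours, an
   automorphism that does not fix a tail of the ray is determined by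
   countably many data; each of them is excluded by a suitable choice between
   two colours for one edge of the ray. *)

(** * Trees and distances *)

Section Distance.
Variables (G : sgraph) (conn : connected_graph G).
Implicit Types x y z : G.

Lemma distP x y : is_dist x y (dist x y).
Proof.
apply: (@xgetPex _ 0 [set n | is_dist x y n]).
have [p xp <-] := conn x y.
have ex : exists n, `[< exists q : seq G,
    [/\ path (@adj G) x q, last x q = last x p & size q = n] >].
  by exists (size p); apply/asboolP; exists p.
exists (ex_minn ex); case: ex_minnP => n /asboolP[q [xq lq sq]] nmin.
by split; [exists q | move=> r xr lr; apply: nmin; apply/asboolP; exists r].
Qed.

Lemma dist_path x p : path (@adj G) x p -> dist x (last x p) <= size p.
Proof. by move=> xp; have [_ /(_ p)] := distP x (last x p); apply. Qed.

Lemma ex_dist_path x y :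
  exists p, [/\ path (@adj G) x p, last x p = y & size p = dist x y].
Proof. by have [] := distP x y. Qed.

Lemma distxx x : dist x x = 0.
Proof. by apply/eqP; rewrite -leqn0 (@dist_path x [::]). Qed.

Lemma dist0_eq x y : dist x y = 0 -> x = y.
Proof. by have [p [_ <- <-]] := ex_dist_path x y => /size0nil->. Qed.

Lemma dist_triangle x y z : dist x z <= dist x y + dist y z.
Proof.
have [p [xp py <-]] := ex_dist_path x y.
have [q [yq qz <-]] := ex_dist_path y z.
have <- : last x (p ++ q) = z by rewrite last_cat py.
by rewrite -size_cat dist_path // cat_path xp py.
Qed.

Lemma adj_dist1 x y : adj x y -> dist x y <= 1.
Proof. by move=> xy; apply: (@dist_path x [:: y]); rewrite /= xy. Qed.

Lemma dist_adj r x y : adj x y -> dist r y <= (dist r x).+1.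
Proof.
move=> xy; apply: leq_trans (dist_triangle r x y) _.
by rewrite -addn1 leq_add2l adj_dist1.
Qed.

Lemma dist_sym_le x y : dist y x <= dist x y.
Proof.
have [p [xp <- <-]] := ex_dist_path x y.
have := @dist_path (last x p) (rev (belast x p)).
rewrite size_rev size_belast.
case: p xp => [|a p] xp; first by rewrite /= distxx.
have -> : last (last x (a :: p)) (rev (belast x (a :: p))) = x.
  by rewrite /= rev_cons last_rcons.
apply; rewrite -rev_path in xp.
by rewrite (@eq_path _ _ (fun u v => adj v u)) // => u v; exact: adj_sym.
Qed.

Lemma distC x y : dist x y = dist y x.
Proof. by apply/eqP; rewrite eqn_leq !dist_sym_le. Qed.

Lemma ex_closer r x : x <> r ->
  exists2 y, adj x y & dist r x = (dist r y).+1.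
Proof.
have [p [+ <- +]] := ex_dist_path r x.
case/lastP: p => [|p y] //; rewrite last_rcons rcons_path size_rcons.
move=> /andP[rp yx] sp _; exists (last r p); first by rewrite adj_sym.
apply/eqP; rewrite eqn_leq dist_adj // -sp ltnS.
exact: dist_path.
Qed.

Lemma dist_automorphism (f : G -> G) x y : automorphism f ->
  dist (f x) (f y) = dist x y.
Proof.
have le_dist (h : G -> G) u v : (forall a b, adj a b -> adj (h a) (h b)) ->
    dist (h u) (h v) <= dist u v.
  move=> hadj; have [p [up <- <-]] := ex_dist_path u v.
  rewrite -last_map -(size_map h) dist_path //.
  by elim: p u up => //= a p IH u /andP[/hadj-> /IH].
move=> [[g fK gK] fadj]; apply/eqP; rewrite eqn_leq le_dist /= => [|a b].
  rewrite -{1}(fK x) -{1}(fK y) le_dist // => a b.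
  by rewrite -{1}(gK a) -{1}(gK b) fadj.
by rewrite fadj.
Qed.

End Distance.

Section RootedTree.
Variables (G : sgraph) (treeG : is_tree G).
Implicit Types r x y z : G.

Let conn : connected_graph G := treeG.1.

(** If a and b were different, a duplicate-free path between them avoiding x would close up through
    x to a cycle with at least three vertices. *)
Lemma branch_uniq x a b (p : seq G) : adj x a -> adj x b ->
  path (@adj G) a p -> last a p = b -> x \notin a :: p -> a = b.
Proof.
move=> xa + ap lp; rewrite -{}lp; case/shortenP: ap => q aq uq sub_qp xb xNp.
case: q aq uq sub_qp xb => //= c q /andP[ac cq] uq sub_qp xb.
case: treeG => _ []; exists [:: x, a, c & q] => //.
apply/andP; split.
  rewrite /= xa ac; move: cq; rewrite -cats1 cat_path => -> /=.
  by move: (xb); rewrite adj_sym => ->.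
rewrite cons_uniq /= uq andbT.
apply: contra xNp; rewrite !inE => /or3P[->//|xc|xq]; apply/orP; right.
  by apply: sub_qp; rewrite inE xc.
by apply: sub_qp; rewrite inE xq orbT.
Qed.

Lemma closer_path r y : exists p, [/\ path (@adj G) y p, last y p = r &
  forall z, z \in p -> dist r z < dist r y].
Proof.
elim: {y}(dist r y) {-2}y (erefl (dist r y)) => [|n IH] y dy.
  by exists [::]; split => //=; rewrite (dist0_eq conn dy).
have [|z yz dz] := @ex_closer G conn r y.
  by move=> yr; rewrite yr distxx in dy.
have [|p [zp lp pz]] := IH z; first by move: dz; rewrite dy => -[].
exists (z :: p); split=> [|//|u]; first by rewrite /= yz.
by rewrite inE dz ltnS => /predU1P[->//|/pz/ltnW].
Qed.

(** Walk from y to r and back out to z along shortest paths. Apart from y and z, all vertices met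
    are closer to r than y or z, hence closer than x. *)
Lemma le_dist_path r x y z : x <> y -> x <> z ->
  dist r y <= dist r x -> dist r z <= dist r x ->
  exists p, [/\ path (@adj G) y p, last y p = z & x \notin y :: p].
Proof.
move=> xy xz dy dz; have [p [yp lp pP]] := closer_path r y.
have [q [zq lq qP]] := closer_path r z.
exists (p ++ rev (belast z q)); split.
- rewrite cat_path yp lp -lq rev_path.
  by rewrite (@eq_path _ _ (@adj G)) // => u v; exact: adj_sym.
- rewrite last_cat lp.
  case: q lq {zq qP} => [|a q] /= lq; first by rewrite lq.
  by rewrite rev_cons last_rcons.
rewrite inE mem_cat mem_rev !negb_or; apply/and3P; split; first exact/eqP.
  by apply/negP => /pP; rewrite ltnNge dy.
apply/negP => /mem_belast; rewrite inE => /predU1P[//|/qP].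
by rewrite ltnNge dz.
Qed.

Lemma closer_uniq r x y z : adj x y -> adj x z ->
  dist r y <= dist r x -> dist r z <= dist r x -> y = z.
Proof.
have neq u : adj x u -> x <> u by move=> + xu; rewrite -xu adj_irr.
move=> xy xz dy dz.
have [p [yp lp xp]] := le_dist_path (neq _ xy) (neq _ xz) dy dz.
exact: branch_uniq xy xz yp lp xp.
Qed.

(** The default value of [xget] makes the root its own parent. *)
Definition parent r x := xget x [set y | adj x y /\ dist r x = (dist r y).+1].

Lemma parentP r x : x <> r ->
  adj x (parent r x) /\ dist r x = (dist r (parent r x)).+1.
Proof.
move=> xr; have [y xy dy] := ex_closer conn xr.
exact: (@xgetPex _ x [set y | adj x y /\ dist r x = (dist r y).+1]
  (ex_intro _ y (conj xy dy))).
Qed.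

Lemma parent_root r : parent r r = r.
Proof. by rewrite /parent; case: xgetP => // y _ []; rewrite distxx. Qed.

Lemma parent_uniq r x y : adj x y -> dist r y <= dist r x -> parent r x = y.
Proof.
move=> xy dy; have [xr|/parentP[xz dz]] := EM (x = r).
  move: dy; rewrite xr (distxx conn) leqn0 => /eqP/(dist0_eq conn) ry.
  by move: xy; rewrite xr -ry adj_irr.
by apply: closer_uniq xz xy _ dy; rewrite dz.
Qed.

Lemma adj_parent r x y : adj x y -> parent r x = y \/ parent r y = x.
Proof.
move=> xy; have [|/ltnW] := leqP (dist r y) (dist r x).
  by left; apply: parent_uniq.
by right; apply: parent_uniq; rewrite // adj_sym.
Qed.

Lemma dist_parent r x : x <> r -> dist r x = (dist r (parent r x)).+1.
Proof. by case/parentP. Qed.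

Lemma dist_parent_adj r x y : adj x y -> parent r x = y ->
  dist r x = (dist r y).+1.
Proof.
move=> xy pxy; rewrite -pxy; apply: dist_parent => xr.
by move: xy; rewrite -pxy xr parent_root adj_irr.
Qed.

End RootedTree.

(** * Orientations of trees *)

Section Orientation.
Variables (G : sgraph) (p : G -> G).
Implicit Types x y z u : G.

(* Every edge joins some x to p x. A vertex with p (p x) = x is a root or an
   end of a central edge; when p leads to an end of the tree there is none. *)
Definition orientation : Prop :=
  (forall x, p x <> x -> adj x (p x)) /\
  (forall x y, adj x y -> p x = y \/ p y = x).

Definition core x := p (p x) == x.

(** Core vertices are excluded so that a root is not its own child and the ends of a central edge
    are not children of each other. *)
Definition child x y := ~~ core y && (p y == x).

(** The list of the edge from x to [p x], stated without constructing an element of [edges G]. If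
    [p x = x] it is the full set, as there are no loops. *)
Definition vertex_list (C : Type) (L : edges G -> set C) x : set C :=
  [set a | forall e : edges G, val e = [set x; p x] -> L e a].

Definition edge_col (C : Type) (col : G -> C) x u :=
  if p u == x then col u else col x.

Hypothesis orp : orientation.

Lemma noncore_moved x : ~~ core x -> p x <> x.
Proof. by move=> + px; rewrite /core !px eqxx. Qed.

Lemma childP x y : reflect (~~ core y /\ p y = x) (child x y).
Proof. by apply: (iffP andP) => -[? /eqP]. Qed.

Lemma child_adj x y : child x y -> adj x y.
Proof. by case/childP => /noncore_moved/orp.1; rewrite adj_sym => + <-. Qed.

Lemma adj_edge x y : adj x y -> exists e : edges G, val e = [set x; y].
Proof.
move=> xy; have e_xy : [set x; y] \in edges G.
  by apply/mem_set; exists x, y.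
by exists (exist (fun e => e \in edges G) _ e_xy).
Qed.

Lemma vertex_listE (C : Type) (L : edges G -> set C) x : p x <> x ->
  exists e, vertex_list L x = L e.
Proof.
move=> /orp.1/adj_edge[e ve]; exists e; apply/seteqP; split=> a /=; first exact.
by move=> La e' ve'; have -> : e' = e by apply: val_inj; rewrite ve ve'.
Qed.

Lemma set2_inj (x y u v : G) : [set x; y] = [set u; v] ->
  x = u /\ y = v \/ x = v /\ y = u.
Proof.
move=> e; have [] : [set u; v] x by rewrite -e; left.
all: have [] : [set u; v] y by rewrite -e; right.
all: have [] : [set x; y] u by rewrite e; left.
all: have [] : [set x; y] v by rewrite e; right.
all: by move=> /= *; subst; tauto.
Qed.

(** From here on colours live on vertices: an edge takes the colour of an end x whose [p x] is the
    other end. Only a central edge has two such ends, and the second hypothesis makes them agree. *)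
Lemma colouring_of_vertices (C : Type) (L : edges G -> set C) (col : G -> C) :
  (forall x, p x <> x -> vertex_list L x (col x)) ->
  (forall x, core x -> col (p x) = col x) ->
  (forall f, automorphism f ->
     (forall x u, adj x u ->
        edge_col col (f x) (f u) = edge_col col x u) ->
     forall x, f x = x) ->
  exists c : edges G -> C, (forall e, L e (c e)) /\ distinguishing c.
Proof.
move=> colL colcore rigid.
have repr (e : edges G) : exists x, p x <> x /\ val e = [set x; p x].
  case: e => A eA; have [x [y [xy AE]]] := set_mem eA; rewrite /= AE {A eA AE}.
  have nxy : x <> y by move=> exy; rewrite exy adj_irr in xy.
  case: (orp.2 _ _ xy) => pxy; [exists x | exists y]; rewrite pxy; split=> //.
    by move=> yx; apply: nxy.
  by rewrite setUC.
pose low e := sval (cid (repr e)).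
have lowP e : p (low e) <> low e /\ val e = [set low e; p (low e)].
  exact: svalP (cid (repr e)).
have colE (e : edges G) x u : adj x u -> val e = [set x; u] ->
    col (low e) = edge_col col x u.
  have [_ ->] := lowP e; rewrite /edge_col => xu /set2_inj[] [lx px].
    have pxu : p x = u by rewrite -lx.
    case: eqP => pu; last by rewrite lx.
    by rewrite lx -pxu colcore // /core pxu pu.
  by rewrite -lx px eqxx.
exists (fun e => col (low e)); split=> [e|f autf pres].
  by have [ne ve] := lowP e; apply: (colL _ ne e ve).
apply: rigid => // x u xu.
have fxu : adj (f x) (f u) by rewrite autf.2.
have [e ve] := adj_edge xu; have [e' ve'] := adj_edge fxu.
rewrite -(colE _ _ _ xu ve) -(colE _ _ _ fxu ve'); apply: pres.
by rewrite ve ve' image_setU !image_set1.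
Qed.

Lemma edge_col_parent (C : Type) (col : G -> C) x :
  edge_col col (p x) x = col x.
Proof. by rewrite /edge_col eqxx. Qed.

Section Words.
Variables (C : Type) (col : G -> C).

Fixpoint reads x (w : seq C) : Prop :=
  if w is a :: w' then exists y, [/\ child x y, col y = a & reads y w']
  else True.

End Words.

Section Depth.
Variables (dp : G -> nat).
Hypothesis dpP : forall x, ~~ core x -> dp x = (dp (p x)).+1.

Lemma depth_ind (P : G -> Prop) : (forall x, core x -> P x) ->
  (forall x, ~~ core x -> P (p x) -> P x) -> forall x, P x.
Proof.
move=> Pcore Pstep x.
elim: {x}(dp x) {-2}x (erefl (dp x)) => [|n IH] x dx;
  have [/Pcore//|ncx] := boolP (core x).
  by move: (dpP ncx); rewrite dx.
by apply: (Pstep x ncx); apply: IH; move: (dpP ncx); rewrite dx => -[].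
Qed.

Section Automorphism.
Variables (f : G -> G) (autf : automorphism f).
Hypothesis f_core : forall x, core x -> f (p x) = p (f x).

Let f_inj : injective f := bij_inj autf.1.

(** Induction away from the core: if f reversed the edge from x to [p x], then f would agree at x
    and at [p (p x)], so x would be a core vertex. *)
Lemma automorphism_parent x : f (p x) = p (f x).
Proof.
elim/depth_ind: x => // x ncx IH.
have : adj (f x) (f (p x)) by rewrite autf.2; apply: orp.1;
    apply: noncore_moved.
case/orp.2 => // pfp; case/negP: ncx.
by move: pfp; rewrite -IH => /f_inj ppx; apply/eqP.
Qed.

Lemma automorphism_core x : core (f x) = core x.
Proof. by rewrite /core -!automorphism_parent (inj_eq f_inj). Qed.

Lemma automorphism_child x y : child (f x) (f y) = child x y.
Proof. by rewrite /child automorphism_core -automorphism_parent (inj_eq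
    f_inj). Qed.

Variables (C : Type) (col : G -> C).
Hypothesis col_f : forall x u, adj x u ->
  edge_col col (f x) (f u) = edge_col col x u.

Lemma automorphism_col x : ~~ core x -> col (f x) = col x.
Proof.
move=> ncx; rewrite -(edge_col_parent col x) -col_f.
  by rewrite automorphism_parent edge_col_parent.
by rewrite adj_sym; apply: orp.1; apply: noncore_moved.
Qed.

Lemma automorphism_reads x w : reads col (f x) w <-> reads col x w.
Proof.
have [g fK gK] := autf.1.
elim: w x => //= a w IH x; split=> -[y [xy <- yw]].
  exists (g y); rewrite -{1}(gK y) automorphism_child in xy.
  split=> //; last by apply/IH; rewrite gK.
  by rewrite -automorphism_col ?gK //; case/childP: xy.
exists (f y); split; first by rewrite automorphism_child.
  by rewrite automorphism_col //; case/childP: xy.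
exact/IH.
Qed.

(* The set of colour words that can be read downwards from a vertex replaces
   the isomorphism type of the coloured subtree below it. *)
Lemma automorphism_fixed :
  (forall x y, ~~ core x -> ~~ core y -> p x = p y -> col x = col y ->
     reads col x = reads col y -> x = y) ->
  (forall x, core x -> f x = x) -> forall x, f x = x.
Proof.
move=> good fixc; elim/depth_ind=> // x ncx IH; apply: good => //.
- by rewrite automorphism_core.
- by rewrite -automorphism_parent IH.
- exact: automorphism_col.
by apply/funext => w; apply/propext; exact: automorphism_reads.
Qed.

End Automorphism.
End Depth.
End Orientation.

(** * Recolouring finite subtrees *)

(** Greedy choice: each colour chosen joins the forbidden set F for the remaining elements, and the
    size bound always leaves a colour in the next list. *)
Lemma distinct_representatives (V C : eqType) (k : nat) (l : V -> seq C)
    (c0 : V -> C) (s : seq V) (F : seq C) :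
  uniq s -> {in s, forall x, uniq (l x) /\ size (l x) = k} ->
  size s + size F <= k ->
  exists col : V -> C,
    {in s, forall x, (col x \in l x) && (col x \notin F)} /\
    {in s &, injective col}.
Proof.
elim: s F => [|x s IH] F; first by exists c0; split.
move=> /= /andP[xs us] ls; rewrite addSn => sF.
have [ulx slx] := ls x (mem_head _ _).
have /hasP[a alx aF] : has (fun a => a \notin F) (l x).
  apply: contraLR sF; rewrite -all_predC => /allP lF.
  rewrite -ltnNge ltnS -slx; apply: leq_trans (leq_addl _ _).
  by apply: uniq_leq_size => // b /lF /=; rewrite negbK.
have [||col [colP colI]] := IH (a :: F) us.
- by move=> y ys; apply: ls; rewrite inE ys orbT.
- by rewrite /= addnS.
exists (fun y => if y == x then a else col y); split=> [y|y z].
  rewrite inE; case: eqP => [->|_] /=; first by rewrite alx.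
  by move=> /colP/andP[->]; rewrite inE negb_or => /andP[].
have cola u : u \in s -> col u != a.
  by move=> /colP/andP[_]; rewrite inE negb_or => /andP[].
rewrite !inE; case: (eqVneq y x) => [->|_] /=; case: (eqVneq z x) => [->|_] //=.
- by move=> _ /cola/eqP + ac; rewrite -ac.
- by move=> /cola/eqP.
by move=> ys zs; exact: colI.
Qed.

Section Recolouring.
Variables (G : sgraph) (p : G -> G).
Implicit Types x y z : G.
Variables (C : eqType) (k : nat) (chs : G -> seq G) (l : G -> seq C).
Hypotheses (k_gt0 : 0 < k).
Hypothesis chs_uniq : forall x, uniq (chs x).
Hypothesis mem_chs : forall x y, (y \in chs x) = child p x y.
Hypothesis l_uniq : forall x, ~~ core p x -> uniq (l x).
Hypothesis size_l : forall x, ~~ core p x -> size (l x) = k.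

(** The predicate D selects the parents whose child edges must get distinct colours. A root with k +
    1 children is left out, since its lists have only k colours. *)
Definition proper_at (D : pred G) (col : G -> C) :=
  (forall y, ~~ core p y -> col y \in l y) /\
  (forall y z, ~~ core p y -> ~~ core p z -> p y = p z -> D (p y) ->
     col y = col z -> y = z).

Lemma ex_proper (D : pred G) (c0 : G -> C) :
  (forall x, D x -> size (chs x) <= k) ->
  (forall y, ~~ core p y -> ~~ D (p y) -> c0 y \in l y) ->
  exists2 col, proper_at D col &
    forall y, ~~ core p y -> ~~ D (p y) -> col y = c0 y.
Proof.
move=> chs_le c0l.
have loc x : exists g : G -> C, if D x then
      {in chs x, forall y, g y \in l y} /\ {in chs x &, injective g}
    else g = c0.
  case Dx : (D x); last by exists c0.
  have [||g [gl gI]] :=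
      @distinct_representatives _ _ k l c0 (chs x) [::] (chs_uniq x).
  - by move=> y; rewrite mem_chs => /childP[ncy _]; split;
      [exact: l_uniq|exact: size_l].
  - by rewrite addn0 chs_le.
  by exists g; split=> // y /gl/andP[].
have [g gP] := choice loc.
exists (fun y => g (p y) y); last by move=> y _ nD; move: (gP (p y));
    rewrite (negPf nD) => ->.
split=> [y ncy|y z ncy ncz pyz Dy].
  have := gP (p y); case: ifPn => [_ [gl _]|nD ->]; last exact: c0l.
  by apply: gl; rewrite mem_chs; apply/childP.
have := gP (p y); rewrite Dy -pyz => -[_]; apply; rewrite mem_chs; exact/childP.
Qed.

Inductive below x : G -> Prop :=
| below_child y : child p x y -> below x y
| below_step y z : below x y -> child p y z -> below x z.

Lemma below_inv x z : below x z -> ~~ core p z /\ (p z = x \/ below x (p z)).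
Proof.
case=> [y /childP[ncy pyx]|y w xy /childP[ncw pwy]]; split=> //; first by left.
by right; rewrite pwy.
Qed.

Lemma below_trans x y z : child p x y -> below y z -> below x z.
Proof.
move=> xy; elim=> [w yw|w u yw xw wu]; last exact: below_step wu.
exact: below_step (below_child xy) yw.
Qed.

(** The ancestors of z form a chain. *)
Lemma below_comparable x y z : below x z -> below y z ->
  [\/ x = y, below x y | below y x].
Proof.
move=> xz; elim: xz y => {z} [z xz|w z xw IH wz] y /below_inv[_ yz].
  by case/childP: xz yz => _ -> [->|]; [constructor 1|constructor 3].
by case/childP: wz yz => _ -> [<-|/IH//]; constructor 2.
Qed.

Lemma reads_agree (col col' : G -> C) x :
  (forall z, below x z -> col' z = col z) -> reads p col' x = reads p col x.
Proof.
move=> agr; apply/funext => w; apply/propext.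
elim: w x agr => //= a w IH x agr.
have agr_y y : child p x y -> forall z, below y z -> col' z = col z.
  by move=> xy z yz; apply: agr; apply: below_trans xy yz.
split=> -[y [xy <- yw]]; exists y; split=> //.
- by rewrite agr //; exact: below_child.
- by apply/(IH y (agr_y y xy)).
- by rewrite agr //; exact: below_child.
by apply/(IH y (agr_y y xy)).
Qed.

(** The full k-ary tree of height h. If all lists coincide, every proper colouring of it reads all
    words of length at most h, so recolouring cannot distinguish two copies. *)
Fixpoint perfect (h : nat) x : Prop :=
  if h is h'.+1 then size (chs x) = k /\ {in chs x, forall y, perfect h' y}
  else chs x = [::].

Lemma perfect_reads (col : G -> C) h x : perfect h x ->
  exists2 w, reads p col x w & size w = h.
Proof.
elim: h x => [|h IH] x /=; first by exists [::].
case E: (chs x) => [|y s] [sk per]; first by move: k_gt0; rewrite -sk.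
have ys : y \in chs x by rewrite E mem_head.
have [|w yw sw] := IH y; first by apply: per; rewrite mem_head.
exists (col y :: w); last by rewrite /= sw.
by exists y; split=> //; rewrite -mem_chs.
Qed.

Lemma perfect_reads_le (col : G -> C) h x w : perfect h x ->
  reads p col x w -> size w <= h.
Proof.
elim: h x w => [|h IH] x [|a w] //= perx [y [xy _ yw]].
  by move: xy; rewrite -mem_chs perx.
by rewrite ltnS; apply: IH yw; apply: perx.2; rewrite mem_chs.
Qed.

(** The height of a perfect subtree is the greatest length of a word read in it. *)
Lemma perfect_reads_neq (col : G -> C) h h' x y :
  perfect h x -> perfect h' y -> h <> h' -> reads p col x <> reads p col y.
Proof.
move=> px py hh E; apply: hh; apply/eqP; rewrite eqn_leq.
have [w xw sw] := perfect_reads col px;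
    have [w' yw' sw'] := perfect_reads col py.
rewrite -{1}sw -{2}sw'; apply/andP; split.
  by apply: (@perfect_reads_le col) py _; rewrite -E; exact: xw.
by apply: (@perfect_reads_le col) px _; rewrite E; exact: yw'.
Qed.

Variables (D : pred G) (dp : G -> nat) (N : nat).
Hypothesis noncoreD : forall x, ~~ core p x -> D x.
Hypothesis chs_le : forall x, D x -> size (chs x) <= k.
Hypothesis dpP : forall x, ~~ core p x -> dp x = (dp (p x)).+1.
Hypothesis dp_le : forall x, dp x <= N.

Lemma below_depth x y : below x y -> dp x < dp y.
Proof.
elim=> [z /childP[/dpP-> ->] //|z w _ /leq_trans + /childP[/dpP-> ->]].
exact.
Qed.

(** As siblings have distinct colours, the first letter of a word determines the child; hence a
    change of the words read at y is visible at x. *)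
Lemma reads_cons col x y w : proper_at D col -> D x -> child p x y ->
  reads p col x (col y :: w) <-> reads p col y w.
Proof.
move=> [_ colI] Dx xy; split=> [[z [xz czy zw]]|yw]; last by exists y.
have /childP[ncz pz] := xz; have /childP[ncy py] := xy.
by rewrite -(colI z y) ?pz.
Qed.

Lemma recolour_child col x y d : proper_at D col -> child p x y -> d \in l y ->
  d \notin map col (chs x) ->
  let col' z := if z == y then d else col z in
  proper_at D col' /\ reads p col' x <> reads p col x.
Proof.
move=> [colL colI] xy dl dS col'; have /childP[ncy py] := xy.
have nd z : ~~ core p z -> p z = p y -> col z <> d.
  move=> ncz pz dz; case/negP: dS; rewrite -dz; apply: map_f.
  by rewrite mem_chs; apply/childP; rewrite pz.
split; first split.
- by move=> z ncz; rewrite /col'; case: eqP => [->//|_]; exact: colL.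
- move=> z z' ncz ncz' pzz Dz; rewrite /col'.
  case: (eqVneq z y) => [zy|zy]; case: (eqVneq z' y) => [z'y|z'y] cc.
  + by rewrite zy z'y.
  + by case: (nd z'); rewrite -?pzz ?zy.
  + by case: (nd z); rewrite ?pzz ?z'y.
  exact: colI.
move=> E; have : reads p col' x [:: d].
  by exists y; rewrite /col' eqxx.
rewrite E => -[z [xz cz _]]; case/negP: dS; rewrite -cz.
by apply: map_f; rewrite mem_chs.
Qed.

Lemma swap_children col x y1 y2 h1 h2 : proper_at D col -> D x ->
  child p x y1 -> child p x y2 -> perfect h1 y1 -> perfect h2 y2 -> h1 < h2 ->
  col y1 \in l y2 -> col y2 \in l y1 ->
  let tau z := if z == y1 then y2 else if z == y2 then y1 else z in
  proper_at D (col \o tau) /\ reads p (col \o tau) x <> reads p col x.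
Proof.
move=> prop Dx xy1 xy2 per1 per2 h12 c1 c2 tau; have [colL colI] := prop.
have /childP[nc1 p1] := xy1; have /childP[nc2 p2] := xy2.
have tauK z : tau (tau z) = z.
  rewrite /tau; case: (eqVneq z y1) => [->|n1].
    by rewrite eqxx; case: eqP.
  by case: (eqVneq z y2) => [->|n2]; rewrite ?eqxx // (negPf n1) (negPf n2).
have taup z : p (tau z) = p z.
  rewrite /tau; case: (eqVneq z y1) => [->|n1]; first by rewrite p1 p2.
  by case: (eqVneq z y2) => [->|n2]; rewrite ?p1 ?p2.
have tauc z : ~~ core p z -> ~~ core p (tau z).
  by move=> ncz; rewrite /tau; case: eqP => // _; case: eqP.
split; first split.
- move=> z ncz /=; rewrite /tau; case: (eqVneq z y1) => [->//|n1].
  by case: (eqVneq z y2) => [->//|n2]; apply: colL.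
- move=> z z' ncz ncz' pzz Dz /= cc; rewrite -(tauK z) -(tauK z').
  by congr tau; apply: colI; rewrite ?taup //; exact: tauc.
have tau2 : tau y2 = y1.
  by rewrite /tau eqxx; case: eqP.
(* After the exchange the old colour of y1 is followed by a word of length h2, too long for the
   subtree of y1. *)
have [w rw sw] := perfect_reads (col \o tau) per2.
move=> E; have : reads p (col \o tau) x (col y1 :: w).
  by exists y2; rewrite /= tau2.
rewrite E => /(reads_cons _ prop Dx xy1)/(perfect_reads_le per1).
by rewrite sw leqNgt h12.
Qed.

(* If some child can take a colour absent from its siblings, recolour it: a new
   word of length 1 appears. Otherwise all lists of the children of x equal
   the set of colours used on them, so one may either recolour inside the
   subtree of a child that is not perfect, or exchange the colours of two
   children carrying perfect subtrees of different heights. *)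
Lemma recolour_subtree x col : D x -> proper_at D col ->
  (exists h, perfect h x) \/ exists col', [/\ proper_at D col',
    forall y, ~ below x y -> col' y = col y & reads p col' x <> reads p col x].
Proof.
(* The induction runs upwards through the tree, whose depth is bounded by N. *)
have [n nx] := ubnP (N.+1 - dp x).
elim: n x nx col => // n IH x nx col Dx prop.
have [colL colI] := prop.
case: (boolP (has (fun y => has (fun d => d \notin map col (chs x)) (l y))
    (chs x))).
  case/hasP=> y; rewrite mem_chs => xy /hasP[d dl dS]; right.
  have [] := recolour_child prop xy dl dS; set col' := fun z => _.
  move=> prop' neq; exists col'; split=> // z nz; rewrite /col'.
  by case: eqP => // zy; case: nz; rewrite zy; exact: below_child.
move=> /hasPn full.
have lsub y : y \in chs x -> {subset l y <= map col (chs x)}.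
  by move=> /full/hasPn fy d /fy; rewrite negbK.
case E : (chs x) => [|y0 s]; first by left; exists 0.
have y0x : y0 \in chs x by rewrite E mem_head.
(* A list of k colours contained in a sequence of at most k colours exhausts it. *)
have lP y : y \in chs x -> size (chs x) = k /\ l y =i map col (chs x).
  move=> yx; have /childP[ncy _] : child p x y by rewrite -mem_chs.
  have [|sz eqm] := uniq_min_size (l_uniq ncy) (lsub y yx).
    by rewrite size_map size_l ?chs_le.
  by split=> //; rewrite -(size_l ncy) sz size_map.
have [[y yx nper]|allper] :=
    EM (exists2 y, y \in chs x & ~ exists h, perfect h y).
  have xy : child p x y by rewrite -mem_chs.
  have /childP[ncy py] := xy.
  have [|//|[col' [prop' agr neq]]] := IH y _ col (noncoreD ncy) prop.
    have := dpP ncy; rewrite py => dy.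
    have dN : dp x < N by rewrite -dy.
    by move: nx; rewrite dy subSS subSn // ltnW.
  right; exists col'; split=> // [z nz|Eq].
    by apply: agr => yz; apply: nz; exact: below_trans xy yz.
  apply: neq; apply/funext => w; apply/propext.
  have cy : col' y = col y by apply: agr => /below_depth; rewrite ltnn.
  rewrite -(reads_cons w prop' Dx xy) -(reads_cons w prop Dx xy) cy.
  by rewrite Eq.
have per y : y \in chs x -> exists h, perfect h y.
  by move=> yx; apply: contrapT => ny; apply: allper; exists y.
have [h per0] := per y0 y0x.
have swap y1 y2 h1 h2 : y1 \in chs x -> y2 \in chs x -> perfect h1 y1 ->
    perfect h2 y2 -> h1 < h2 -> exists col', [/\ proper_at D col',
    forall y, ~ below x y -> col' y = col y & reads p col' x <> reads p col x].
  move=> y1x y2x per1 per2 h12.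
  have xy1 : child p x y1 by rewrite -mem_chs.
  have xy2 : child p x y2 by rewrite -mem_chs.
  have [||] := swap_children prop Dx xy1 xy2 per1 per2 h12.
  - by rewrite (lP y2 y2x).2 map_f.
  - by rewrite (lP y1 y1x).2 map_f.
  set tau := fun z => _; move=> prop' neq; exists (col \o tau); split=> // z nz.
  rewrite /= /tau; case: eqP => [zy|_].
    by case: nz; rewrite zy; exact: below_child.
  by case: eqP => // zy; case: nz; rewrite zy; exact: below_child.
have [allh|] := EM (forall y, y \in chs x -> perfect h y).
  by left; exists h.+1; split=> //; exact: (lP y0 y0x).1.
move=> /existsNP[y2 /not_implyP[y2x nper]]; have [h2 per2] := per y2 y2x.
right; have [h12|h21|e] := ltngtP h h2.
- exact: swap per0 per2 h12.
- exact: swap per2 per0 h21.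
by case: nper; rewrite e.
Qed.

End Recolouring.

(** * Orientations towards a vertex or an edge *)

Section CanonicalOrientations.
Variables (G : sgraph) (treeG : is_tree G).
Implicit Types r s x y : G.

Let conn : connected_graph G := treeG.1.

Lemma adj_neq x y : adj x y -> x <> y.
Proof. by move=> + xy; rewrite xy adj_irr. Qed.

Lemma parent_orientation r : orientation (parent r).
Proof.
split=> [x pxx|x y xy]; last exact: adj_parent.
by apply: (parentP treeG _).1 => xr; apply: pxx; rewrite xr parent_root.
Qed.

Lemma parent_core r x : core (parent r) x = (x == r).
Proof.
rewrite /core; case: (eqVneq x r) => [->|/eqP xr];
    first by rewrite !parent_root ?eqxx.
apply/eqP => ppx; have := dist_parent treeG xr.
have [pr|/(dist_parent treeG)->] := EM (parent r x = r).
  by case: xr; rewrite -ppx pr parent_root.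
by rewrite ppx => /eqP; rewrite -addn2 -{1}[dist r x]addn0 eqn_add2l.
Qed.

Lemma parent_depth r x : ~~ core (parent r) x ->
  dist r x = (dist r (parent r x)).+1.
Proof. by rewrite parent_core => /eqP/(dist_parent treeG). Qed.

(** Redirecting only the root r makes rs a central edge, because s already has parent r. *)
Definition edge_parent r s x := if x == r then s else parent r x.

Variables (r s : G).
Hypothesis rs : adj r s.

Lemma parent_adj_root : parent r s = r.
Proof. by apply: parent_uniq => //; rewrite ?distxx // adj_sym. Qed.

Lemma edge_parent_orientation : orientation (edge_parent r s).
Proof.
split=> [x|x y xy].
  rewrite /edge_parent; case: eqP => [->//|_]; exact: (parent_orientation r).1.
have [pxy|pxy] := adj_parent treeG r xy; rewrite /edge_parent.
  case: (eqVneq x r) => [xr|]; last by left.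
  by case: (adj_neq xy); rewrite -pxy xr parent_root.
case: (eqVneq y r) => [yr|]; last by right.
by case: (adj_neq xy); rewrite -pxy yr parent_root.
Qed.

Lemma edge_parent_core x : core (edge_parent r s) x = (x == r) || (x == s).
Proof.
have sr : (s == r) = false by apply/eqP => sr; exact: (adj_neq rs).
rewrite /core /edge_parent; case: (eqVneq x r) => [->|xr].
  by rewrite sr parent_adj_root eqxx.
have [pxr|/eqP pxr] := eqVneq (parent r x) r; first by rewrite eq_sym.
have -> /= : (x == s) = false.
  by apply/eqP => xs; apply: pxr; rewrite xs parent_adj_root.
have := parent_core r x; rewrite (negPf xr) /core.
by move=> ->.
Qed.

Lemma edge_parent_depth x : ~~ core (edge_parent r s) x ->
  dist r x = (dist r (edge_parent r s x)).+1.
Proof.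
rewrite edge_parent_core negb_or /edge_parent => /andP[xr _].
by rewrite (negPf xr); apply: dist_parent => //; exact/eqP.
Qed.

End CanonicalOrientations.

(** * Finite sets as duplicate-free sequences *)

Section FiniteSequences.

Lemma seq_card_eq (V : eqType) (A : set V) (s : seq V) : uniq s ->
  (forall x, (x \in s) <-> A x) -> A #= `I_(size s).
Proof.
elim: s A => [|x s IH] A /=.
  move=> _ A0; suff -> : A = set0 by rewrite II0 card_eq00.
  by apply/seteqP; split=> y // /A0.
move=> /andP[xs us] sA; apply/eq_cardSP; exists x; first by apply/sA;
    exact: mem_head.
apply: IH => // y; split=> [ys|[/sA + yx]].
  by split; [apply/sA; rewrite inE ys orbT | move=> yx; rewrite -yx ys in xs].
by rewrite inE => /predU1P[].
Qed.

Lemma finite_set_seq (V : eqType) (A : set V) : finite_set A ->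
  exists s : seq V, [/\ uniq s, forall x, (x \in s) <-> A x & A #= `I_(size s)].
Proof.
move=> /finite_seqP[s sA].
have mA x : (x \in undup s) <-> A x by rewrite mem_undup sA.
by exists (undup s); split=> //;
    [exact: undup_uniq|apply: seq_card_eq (undup_uniq s) mA].
Qed.

Lemma card_le_seq (V : eqType) (A : set V) n : A #<= `I_n ->
  exists s : seq V, [/\ uniq s, size s <= n & forall x, (x \in s) <-> A x].
Proof.
move=> An; have [|s [us sA cA]] := @finite_set_seq V A.
  by apply/finite_set_leP; exists n.
by exists s; split=> //; rewrite -card_le_II -(card_le_eql cA).
Qed.

Lemma card_eq_seq (V : eqType) (A : set V) n : A #= `I_n ->
  exists s : seq V, [/\ uniq s, size s = n & forall x, (x \in s) <-> A x].
Proof.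
move=> An; have [|s [us sA cA]] := @finite_set_seq V A.
  by apply/finite_setP; exists n.
by exists s; split=> //; apply/card_eq_II; rewrite -(card_eql cA).
Qed.

End FiniteSequences.

(** * Trees with an invariant vertex or edge *)

(** The neighbours of x are its children together with [p x], unless [p x = x]; this accounts for
    the difference of one between the two counts. *)
Lemma ex_children (G : sgraph) (p : G -> G) (k : nat) : orientation p ->
  (forall x : G, nbrs x #<= `I_k.+1) ->
  exists chs : G -> seq G, [/\ forall x, uniq (chs x),
    forall x y, (y \in chs x) = child p x y,
    forall x, p x <> x ->
      size (chs x) <= k /\ nbrs x #= `I_(size (chs x)).+1 &
    forall x, p x = x ->
      size (chs x) <= k.+1 /\ nbrs x #= `I_(size (chs x))].
Proof.
move=> orp deg; have [nb nbP] := choice (fun x => card_le_seq (deg x)).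
have adjP x y : adj x y -> y = p x \/ child p x y.
  move=> /[dup] xy /orp.2[->|pyx]; first by left.
  have [cy|ncy] := boolP (core p y); last by right; apply/childP.
  by left; rewrite -pyx (eqP cy).
pose chs x := filter (child p x) (nb x).
have uchs x : uniq (chs x) by apply: filter_uniq; have [] := nbP x.
have mchs x y : (y \in chs x) = child p x y.
  rewrite mem_filter andb_idr // => /(child_adj orp) xy.
  by have [_ _ nbx] := nbP x; apply/nbx.
have nchs x : p x \notin chs x.
  rewrite mchs; apply/negP => /childP[ncpx ppx].
  by move: ncpx; rewrite /core ppx eqxx.
exists chs; split=> // x px.
- have mem_nb y : (y \in p x :: chs x) <-> nbrs x y.
    rewrite inE mchs; split=> [/predU1P[->|/(child_adj orp)]|/adjP[->|->]].
    + exact: orp.1.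
    + by [].
    + by rewrite eqxx.
    by rewrite orbT.
  have un : uniq (p x :: chs x) by rewrite /= nchs uchs.
  split; last exact: (seq_card_eq un mem_nb).
  have [unb snb nbx] := nbP x.
  rewrite -ltnS; apply: leq_trans snb; apply: (uniq_leq_size un) => y.
  by move=> /mem_nb/nbx.
have mem_nb y : (y \in chs x) <-> nbrs x y.
  rewrite mchs; split=> [/(child_adj orp)//|/[dup] xy /adjP[ypx|//]].
  by move: xy; rewrite /nbrs /= ypx px adj_irr.
split; last exact: (seq_card_eq (uchs x) mem_nb).
have [unb snb nbx] := nbP x.
by apply: leq_trans snb; apply: (uniq_leq_size (uchs x)) => y /mem_nb/nbx.
Qed.

Lemma ex_lists (G : sgraph) (p : G -> G) (C : eqType) (L : edges G -> set C)
    (k : nat) : orientation p -> (forall e, L e #= `I_k) ->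
  exists l : G -> seq C, forall x, p x <> x ->
    [/\ uniq (l x), size (l x) = k &
        forall a, (a \in l x) <-> vertex_list p L x a].
Proof.
move=> orp Lk; suff /choice[l lP] : forall x, exists s : seq C, p x <> x ->
    [/\ uniq s, size s = k & forall a, (a \in s) <-> vertex_list p L x a].
  by exists l.
move=> x.
have [px|px] := EM (p x = x); first by exists [::].
have [e ->] := vertex_listE orp L px.
by have [s sP] := card_eq_seq (Lk e); exists s.
Qed.

Section FiniteCore.
Variables (G : sgraph) (k : nat) (C : eqType) (L : edges G -> set C) (a0 : C).
Hypothesis k_gt0 : 0 < k.
Variables (p : G -> G) (dp : G -> nat) (N : nat).
Hypothesis orp : orientation p.
Hypothesis dpP : forall x, ~~ core p x -> dp x = (dp (p x)).+1.
Hypothesis dp_le : forall x, dp x <= N.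
Variables (chs : G -> seq G) (l : G -> seq C).
Hypothesis chs_uniq : forall x, uniq (chs x).
Hypothesis mem_chs : forall x y, (y \in chs x) = child p x y.
Hypothesis size_chs : forall x, p x <> x -> size (chs x) <= k.
Hypothesis size_chs_root : forall x, p x = x -> size (chs x) <= k.+1.
Hypothesis lP : forall x, p x <> x -> [/\ uniq (l x), size (l x) = k &
  forall a, (a \in l x) <-> vertex_list p L x a].
Hypothesis aut_core : forall f : G -> G, automorphism f ->
  forall x, core p x -> f (p x) = p (f x).

Let l_uniq x : ~~ core p x -> uniq (l x).
Proof. by move=> /noncore_moved/lP[]. Qed.

Let size_l x : ~~ core p x -> size (l x) = k.
Proof. by move=> /noncore_moved/lP[]. Qed.

(** Siblings may share a colour provided that different words are read below them; this is what
    [automorphism_fixed] asks for. *)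
Definition separated (col : G -> C) := forall x y,
  ~~ core p x -> ~~ core p y -> p x = p y -> col x = col y ->
  reads p col x = reads p col y -> x = y.

(** Here a is the colour of the central edge; for a single root the condition on a is vacuous. *)
Lemma separated_colouring (col : G -> C) (a : C) :
  (forall x, ~~ core p x -> col x \in l x) ->
  (forall x, core p x -> p x <> x -> a \in l x) ->
  separated col ->
  (forall f : G -> G, automorphism f -> forall x, core p x ->
     reads p col (f x) = reads p col x -> f x = x) ->
  exists c : edges G -> C, (forall e, L e (c e)) /\ distinguishing c.
Proof.
move=> coll al sep fixc.
pose col1 x := if core p x then a else col x.
have col1E x : ~~ core p x -> col1 x = col x by rewrite /col1 => /negPf->.
have readsE : reads p col1 = reads p col.
  apply/funext => x; apply: (@reads_agree G p C) => z /below_inv[ncz _].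
  exact: col1E.
apply: (colouring_of_vertices orp (col := col1)).
- move=> x px; have [_ _ lx] := lP px; apply/lx; rewrite /col1.
  by case: ifPn => cx; [exact: al|exact: coll].
- move=> x cx; rewrite /col1 cx; have -> // : core p (p x).
  by rewrite /core (eqP cx).
move=> f autf colf.
have corf := aut_core autf.
apply: (automorphism_fixed orp dpP autf corf colf).
  move=> x y ncx ncy; rewrite !col1E // readsE; exact: sep.
move=> x cx; apply: (fixc f autf x cx); apply/funext => w; apply/propext.
rewrite -readsE; exact: (automorphism_reads orp dpP autf corf colf).
Qed.

Lemma proper_separated col : proper_at p l predT col -> separated col.
Proof. by move=> [_ colI] x y ncx ncy pxy cxy _; exact: colI. Qed.

Lemma ex_default : exists c0 : G -> C, forall x, p x <> x -> c0 x \in l x.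
Proof.
suff /choice[c0 c0l] : forall x, exists a, p x <> x -> a \in l x by exists c0.
move=> x.
have [px|px] := EM (p x = x); first by exists a0.
have [_ + _] := lP px; case: (l x) => [|a s] sl; last by exists a => _;
    exact: mem_head.
by move: k_gt0; rewrite -sl.
Qed.

Section Root.
Variable r : G.
Hypothesis coreE : forall x, core p x = (x == r).
Hypothesis r_fixed : forall f : G -> G, automorphism f -> f r = r.
Hypothesis pr : p r = r.

Let finish col : (forall x, ~~ core p x -> col x \in l x) -> separated col ->
  exists c : edges G -> C, (forall e, L e (c e)) /\ distinguishing c.
Proof.
move=> coll sep; apply: (@separated_colouring col a0) => //.
  by move=> x; rewrite coreE => /eqP->; rewrite pr.
by move=> f autf x; rewrite coreE => /eqP->; rewrite r_fixed.
Qed.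

Let D : pred G := fun x => x != r.

Let noncoreD x : ~~ core p x -> D x. Proof. by rewrite coreE. Qed.

Let chs_le x : D x -> size (chs x) <= k.
Proof. by move=> Dx; apply: size_chs; apply: noncore_moved; rewrite coreE. Qed.

Let pD x : ~~ D (p x) -> p x = r. Proof. by rewrite negbK => /eqP. Qed.

Let mem_chs_r x : (x \in chs r) <-> ~~ core p x /\ p x = r.
Proof. by rewrite mem_chs; split=> /childP. Qed.

(** The k children other than y get distinct colours, so y shares its colour with at most one
    sibling z. If y and z also read the same words, recolouring strictly below y changes its words
    and leaves those of z alone. *)
Lemma root_irregular_child y : size (chs r) = k.+1 -> y \in chs r ->
  ~ (exists h, perfect k chs h y) ->
  exists c : edges G -> C, (forall e, L e (c e)) /\ distinguishing c.
Proof.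
move=> szr yr nper; have [c0 c0l] := ex_default.
have rem_sub x : x \in rem y (chs r) -> x \in chs r by exact: mem_rem.
have [||g [gl gI]] := @distinct_representatives _ _ k l c0 (rem y (chs r)) [::]
    (rem_uniq _ (chs_uniq r)).
- by move=> x /rem_sub/mem_chs_r[ncx _]; split; [exact: l_uniq|exact: size_l].
- by rewrite addn0 size_rem // szr.
pose c1 x := if x \in rem y (chs r) then g x else c0 x.
have [|col prop colE] := ex_proper chs_uniq mem_chs l_uniq size_l (D :=
    D) (c0 := c1) chs_le.
  move=> x ncx _; rewrite /c1; case: ifP => [/gl/andP[]//|_].
  by apply: c0l; exact: noncore_moved.
have yP := (mem_chs_r y).1 yr.
have [//|[col' [prop' agr neq]]] := recolour_subtree k_gt0 mem_chs l_uniq size_l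
  noncoreD chs_le dpP dp_le (noncoreD yP.1) prop.
have agr_r x : x \in chs r -> col' x = col x.
  move=> /mem_chs_r[ncx px]; apply: agr => /(below_depth dpP).
  by rewrite (dpP ncx) px (dpP yP.1) yP.2 ltnn.
have reads_r x : x \in chs r -> x <> y -> reads p col' x = reads p col x.
  move=> /mem_chs_r[ncx px] xy; apply: reads_agree => z xz; apply: agr => yz.
  have dxy : dp x = dp y by rewrite (dpP ncx) px (dpP yP.1) yP.2.
  by have [//|/(below_depth dpP)|/(below_depth dpP)] := below_comparable xz yz;
    rewrite dxy ltnn.
have colI u v : u \in chs r -> v \in chs r -> u <> y -> v <> y ->
    col u = col v -> u = v.
  move=> ur vr uy vy; have /mem_chs_r[ncu pu] := ur;
      have /mem_chs_r[ncv pv] := vr.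
  have remP z : z \in chs r -> z <> y -> z \in rem y (chs r).
    by move=> zr /eqP zy; rewrite mem_rem_uniq // inE zy.
  rewrite !colE ?pu ?pv ?negbK // /c1 !remP //; apply: gI; exact: remP.
have sepD cl : proper_at p l D cl -> (forall u, u \in chs r -> cl u = col u) ->
    (forall v, v \in chs r -> v <> y -> col v = col y ->
       reads p cl v = reads p cl y -> False) -> separated cl.
  move=> [_ clI] clr clxy u v ncu ncv puv cuv ruv.
  have [Du|/pD pu] := boolP (D (p u)); first exact: clI.
  have ur : u \in chs r by apply/mem_chs_r.
  have vr : v \in chs r by apply/mem_chs_r; rewrite -puv.
  move: cuv; rewrite !clr // => cuv.
  have [uy|uy] := EM (u = y); have [vy|vy] := EM (v = y).
  - by rewrite uy vy.
  - by case: (clxy v) => //; rewrite -?cuv -?ruv uy.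
  - by case: (clxy u) => //; rewrite ?cuv ?ruv vy.
  exact: colI.
have [[z [zr zy czy rzy]]|nz] := EM (exists z, [/\ z \in chs r, z <> y,
    col z = col y & reads p col z = reads p col y]).
  apply: (finish prop'.1); apply: sepD => // v vr vy cvy.
  have vz : v = z by apply: colI => //; rewrite cvy.
  by rewrite vz reads_r // rzy => /esym.
apply: (finish prop.1); apply: sepD => // v vr vy cvy rvy.
by apply: nz; exists v.
Qed.

(* Two children with perfect subtrees of different heights may share a colour,
   and if their lists are disjoint then all colours can be made distinct. *)
Lemma root_perfect_children y z h h' : size (chs r) = k.+1 ->
  y \in chs r -> z \in chs r -> perfect k chs h y -> perfect k chs h' z ->
  h <> h' ->
  exists c : edges G -> C, (forall e, L e (c e)) /\ distinguishing c.
Proof.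
move=> szr yr zr pery perz hh; have [c0 c0l] := ex_default.
have yz : z != y.
  apply/eqP => zy; move: perz; rewrite zy => pery'.
  exact: (perfect_reads_neq k_gt0 mem_chs (col := c0) pery pery' hh).
pose s := rem z (rem y (chs r)).
have us : uniq s by rewrite !rem_uniq.
have sz : size s = k.-1.
  have zr' : z \in rem y (chs r) by rewrite mem_rem_uniq // inE yz.
  by rewrite size_rem // size_rem // szr.
have memr x : x \in chs r -> [\/ x \in s, x = y | x = z].
  move=> xr; have [->|/eqP xy] := EM (x = y); first by constructor 2.
  have [->|/eqP xz] := EM (x = z); first by constructor 3.
  by constructor 1;
      rewrite mem_rem_uniq ?rem_uniq // inE xz mem_rem_uniq // inE xy.
have sub x : x \in s -> x \in chs r by move=> /mem_rem/mem_rem.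
have ls : {in chs r, forall x, uniq (l x) /\ size (l x) = k}.
  by move=> x /mem_chs_r[ncx _]; split; [exact: l_uniq|exact: size_l].
have nys : y \notin s.
  by apply/negP => /mem_rem; rewrite mem_rem_uniq // inE eqxx.
have nzs : z \notin s by rewrite /s mem_rem_uniq ?rem_uniq // inE eqxx.
have [c1 c1l c1I] : exists2 c1 : G -> C, {in chs r, forall x, c1 x \in l x} &
    {in chs r &, forall u v, c1 u = c1 v ->
      [\/ u = v, u = y /\ v = z | u = z /\ v = y]}.
  have [[a [ay az]]|nint] := EM (exists a, a \in l y /\ a \in l z).
    have [||g [gl gI]] := @distinct_representatives _ _ k l c0 s [:: a] us.
    - by move=> x /sub/ls.
    - by rewrite sz addn1 prednK.
    exists (fun x => if x \in s then g x else a).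
      move=> x /memr[xs|->|->]; rewrite ?(negPf nys) ?(negPf nzs) //.
      by rewrite xs; have /andP[] := gl x xs.
    have ga x : x \in s -> g x <> a.
      by move=> /gl/andP[_]; rewrite inE => /eqP.
    move=> u v /memr[us'|->|->] /memr[vs|->|->];
      rewrite ?us' ?vs ?(negPf nys) ?(negPf nzs) //.
    + by move=> /gI guv; constructor 1; apply: guv.
    + by move=> /ga-/(_ us').
    + by move=> /ga-/(_ us').
    + by move=> /esym/ga-/(_ vs).
    + by constructor 1.
    + by constructor 2.
    + by move=> /esym/ga-/(_ vs).
    + by constructor 3.
    by constructor 1.
  have [|||g [gl gI]] := @distinct_representatives _ _ k l c0 (y :: s) [::].
  - by rewrite /= nys us.
  - by move=> x; rewrite inE => /predU1P[->|/sub]; exact: ls.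
  - by rewrite /= sz addn0 prednK.
  (* The colour of z is only required to avoid the colours on s; it differs from that of y because
     the two lists are disjoint. *)
  have [|||g' [gl' gI']] :=
      @distinct_representatives _ _ k l c0 [:: z] (map g s).
  - by [].
  - by move=> x; rewrite inE => /eqP->; exact: ls.
  - by rewrite size_map sz /= add1n prednK.
  have /andP[gz gzs] := gl' z (mem_head _ _).
  have gls x : x \in y :: s -> g x \in l x by move=> /gl/andP[].
  have gz_neq x : x \in y :: s -> g x <> g' z.
    rewrite inE => /predU1P[->|xs] gx; last by rewrite -gx map_f in gzs.
    by apply: nint; exists (g y); rewrite {2}gx gls // mem_head.
  have mems x : x \in chs r -> x = z \/ (x == z = false) /\ x \in y :: s.
    move=> /memr[xs|->|->]; last by left.
      right; rewrite inE xs orbT; split=> //; apply/eqP => xz.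
      by rewrite -xz xs in nzs.
    by right; rewrite mem_head eq_sym (negPf yz).
  exists (fun x => if x == z then g' z else g x).
    by move=> x /mems[->|[-> /gls//]]; rewrite eqxx.
  move=> u v /mems[->|[-> us']] /mems[->|[-> vs]]; rewrite ?eqxx.
  + by constructor 1.
  + by move=> /esym/gz_neq-/(_ vs).
  + by move=> /gz_neq-/(_ us').
  by move=> /gI guv; constructor 1; apply: guv.
have [|col prop colE] := ex_proper chs_uniq mem_chs l_uniq size_l (D :=
    D) (c0 := c1) chs_le.
  by move=> x ncx /pD px; apply: c1l; apply/mem_chs_r.
apply: (finish prop.1) => u v ncu ncv puv cuv ruv.
have [Du|nDu] := boolP (D (p u)); first exact: prop.2.
have pu := pD nDu.
have ur : u \in chs r by apply/mem_chs_r.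
have vr : v \in chs r by apply/mem_chs_r; rewrite -puv.
move: cuv; rewrite !colE -?puv // => /(c1I _ _ ur vr)[//|[uy vz]|[uz vy]].
  have := perfect_reads_neq k_gt0 mem_chs (col := col) pery perz hh.
  by rewrite -uy -vz ruv.
have := perfect_reads_neq k_gt0 mem_chs (col := col) pery perz hh.
by rewrite -uz -vy ruv.
Qed.

Lemma root_colouring :
  (exists h, size (chs r) = k.+1 /\ {in chs r, forall y, perfect k chs h y}) \/
  exists c : edges G -> C, (forall e, L e (c e)) /\ distinguishing c.
Proof.
have [szr|szr] := leqP (size (chs r)) k.
  right; have [c0 _] := ex_default.
  have [||col prop _] := ex_proper chs_uniq mem_chs l_uniq size_l (D :=
      predT) (c0 := c0).
  - move=> x _; have [->//|/eqP xr] := EM (x = r).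
    by apply: chs_le.
  - by [].
  exact: finish prop.1 (proper_separated prop).
have {}szr : size (chs r) = k.+1.
  by apply/eqP; rewrite eqn_leq szr size_chs_root.
have [[y [yr nper]]|allper] := EM (exists y, y \in chs r /\
    ~ exists h, perfect k chs h y).
  by right; exact: root_irregular_child nper.
have per y : y \in chs r -> exists h, perfect k chs h y.
  by move=> yr; apply: contrapT => ny; apply: allper; exists y.
case E : (chs r) => [|y s]; first by rewrite E in szr.
have yr : y \in chs r by rewrite E mem_head.
have [h pery] := per y yr.
have [allh|] := EM (forall z, z \in chs r -> perfect k chs h z).
  by left; exists h; rewrite -E.
move=> /existsNP[z /not_implyP[zr nper]]; have [h' perz] := per z zr.
right; apply: (root_perfect_children szr yr zr pery perz) => hh.
by apply: nper; rewrite hh.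
Qed.

End Root.

Section CentralEdge.
Variables r s : G.
Hypothesis coreE : forall x, core p x = (x == r) || (x == s).
Hypothesis ps : p s = r.
Hypothesis pr : p r = s.
Hypothesis rs : r <> s.
Hypothesis rs_fixed : forall f : G -> G, automorphism f ->
  f r = r /\ f s = s \/ f r = s /\ f s = r.

(** It suffices that r and s read different words, which prevents their exchange. If they read the
    same words, recolouring below one end leaves the words of the other unchanged. *)
Lemma central_edge_colouring :
  (exists h, perfect k chs h r /\ perfect k chs h s) \/
  exists c : edges G -> C, (forall e, L e (c e)) /\ distinguishing c.
Proof.
have [c0 c0l] := ex_default.
have chs_le x : predT x -> size (chs x) <= k.
  move=> _; apply: size_chs; have [|] := boolP (core p x).
    by rewrite coreE => /orP[]/eqP->; rewrite ?pr ?ps // => /esym.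
  exact: noncore_moved.
have finish col : proper_at p l predT col -> reads p col r <> reads p col s ->
    exists c : edges G -> C, (forall e, L e (c e)) /\ distinguishing c.
  move=> prop neq.
  apply: (@separated_colouring col (c0 r) prop.1 _ (proper_separated prop)).
    move=> x; rewrite coreE => /orP[]/eqP-> px; first exact: c0l.
    have [_ _ ls] := lP px; apply/ls => e; rewrite ps setUC -pr => ve.
    have [_ _ lr] : [/\ uniq (l r), size (l r) = k &
        forall a, (a \in l r) <-> vertex_list p L r a].
      by apply: lP; rewrite pr => /esym.
    by apply: ((lr (c0 r)).1 _ e); rewrite // c0l // pr => /esym.
  move=> f autf x; rewrite coreE.
  have [[fr fs]|[fr fs]] := rs_fixed autf => /orP[]/eqP->; rewrite ?fr ?fs //.
  by move=> /esym.
have [||col prop _] := ex_proper chs_uniq mem_chs l_uniq size_l (D :=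
    predT) (c0 := c0).
- exact: chs_le.
- by [].
have [neq|eqrs] := EM (reads p col r <> reads p col s); first by right;
    exact: finish neq.
move: eqrs => /contrapT eqrs.
have recol x :=
    @recolour_subtree G p C k chs l k_gt0 mem_chs l_uniq size_l predT
  dp N (fun _ _ => isT) chs_le dpP dp_le x col isT prop.
have nbelow x y z : core p x -> core p y -> x <> y -> below p x z ->
    ~ below p y z.
  by move=> cx cy xy xz yz;
    have [//|/below_inv[]|/below_inv[]] := below_comparable xz yz;
        rewrite ?cx ?cy.
have cr : core p r by rewrite coreE eqxx.
have cs : core p s by rewrite coreE eqxx orbT.
have [[h perr]|[col' [prop' agr neq]]] := recol r; last first.
  right; apply: finish prop' _; rewrite [reads p col' s](_ : _ = reads p col s).
    by rewrite -eqrs.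
  by apply: reads_agree => z sz; apply: agr; apply: nbelow sz => // /esym.
have [[h' pers]|[col' [prop' agr neq]]] := recol s; last first.
  right; apply: finish prop' _; rewrite [reads p col' r](_ : _ = reads p col r).
    by rewrite eqrs => /esym.
  by apply: reads_agree => z rz; apply: agr; apply: nbelow rz.
left; exists h; split=> //; have [->//|hh] := EM (h = h').
by case: (perfect_reads_neq k_gt0 mem_chs (col := col) perr pers hh).
Qed.

End CentralEdge.
End FiniteCore.

(** * Finite trees *)

Section Center.
Variables (G : sgraph) (treeG : is_tree G).
Hypothesis finG : finite_set [set: G].
Implicit Types u v w x y z : G.

Let conn : connected_graph G := treeG.1.

Lemma finite_dist_bound v : exists N, forall x, dist v x <= N.
Proof.
have [s sP] := (finite_seqP [set: G]).1 finG.
exists (\max_(x <- s) dist v x) => x; apply: leq_bigmax_seq => //.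
by have : [set: G] x by []; rewrite sP.
Qed.

Lemma ex_ecc v : exists n, is_ecc v n.
Proof.
have [N vN] := finite_dist_bound v.
have ex : exists n, `[< exists w, dist v w = n >].
  by exists (dist v v); apply/asboolP; exists v.
have ub n : `[< exists w, dist v w = n >] -> n <= N.
  by move=> /asboolP[w <-].
exists (ex_maxn ex ub); case: ex_maxnP => n /asboolP[w wn] nmax.
by split=> [|u]; [exists w|apply: nmax; apply/asboolP; exists u].
Qed.

Lemma center_nonempty v : center G !=set0.
Proof.
have ex : exists n, `[< exists u : G, is_ecc u n >].
  by have [n vn] := ex_ecc v; exists n; apply/asboolP; exists v.
case: (ex_minnP ex) => n /asboolP[u un] nmin; exists u; exists n => // w m wm.
by apply: nmin; apply/asboolP; exists w.
Qed.

(** The distance from z is convex along the path from u to v, of which w is an inner vertex: once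
    the path moves away from z, it does so up to v. *)
Lemma dist_between u v w z : u <> v -> w <> v -> parent v u = w ->
  dist z w < maxn (dist z u) (dist z v).
Proof.
move=> uv wv puw; have uw : adj u w by rewrite -puw;
    exact: (parentP treeG uv).1.
rewrite leq_max; have [zuw|zwu] := adj_parent treeG z uw.
  by rewrite -(dist_parent_adj treeG uw zuw) leqnn.
apply/orP; right; pose q n := iter n (parent v) u.
have dq n : n <= dist v u -> dist v (q n) + n = dist v u.
  elim: n => [|n IH] nu; first by rewrite addn0.
  rewrite addnS -addSn -dist_parent ?IH //; first exact: ltnW.
  move=> qv; have := IH (ltnW nu); rewrite [q n]qv distxx // add0n => E.
  by rewrite -E ltnn in nu.
have qv n : n < dist v u -> q n <> v.
  move=> nu qn; have := dq n (ltnW nu); rewrite qn distxx // add0n => E.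
  by rewrite -E ltnn in nu.
have qadj n : n < dist v u -> adj (q n.+1) (q n).
  by move=> nu; rewrite adj_sym; exact: (parentP treeG (qv n nu)).1.
(* Turning back towards z after [q n.+1] would give [q n.+2 = q n], against their distances from
   v. *)
have pq n : n < dist v u -> parent z (q n.+1) = q n.
  elim: n => [|n IH] nu; first by rewrite /q /= puw.
  have [//|qn] := adj_parent treeG z (qadj _ nu).
  have := IH (ltnW nu); rewrite qn => qq.
  have := dq n.+2 nu; have := dq n (ltnW (ltnW nu)); rewrite qq => <- /eqP.
  by rewrite eqn_add2l -addn2 -{2}[n]addn0 eqn_add2l.
have dzq n : n <= dist v u -> dist z (q n) = dist z u + n.
  elim: n => [|n IH] nu; first by rewrite addn0.
  by rewrite (dist_parent_adj treeG (qadj n nu) (pq n nu)) IH ?addnS // ltnW.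
have qlast : q (dist v u) = v.
  by apply/esym/(dist0_eq conn)/eqP; rewrite -(eqn_add2r (dist v u)) dq.
have d2 : 1 < dist v u.
  rewrite (dist_parent treeG uv) puw ltnS lt0n;
      apply/eqP => /(dist0_eq conn) vw.
  exact: wv.
have -> : dist z w = dist z u + 1.
  by rewrite -puw -[parent v u]/(q 1) dzq // ltnW.
by have := dzq _ (leqnn _); rewrite qlast => ->; rewrite ltn_add2l.
Qed.

(** Otherwise, by [dist_between], the neighbour of u on the path to v has smaller eccentricity than
    u or v, against minimality. *)
Lemma center_adj u v : center G u -> center G v -> u <> v -> adj u v.
Proof.
move=> [n [_ un] nmin] [m [_ vm] mmin] uv.
have [wv|wv] := EM (parent v u = v).
  by have := (parentP treeG uv).1; rewrite wv.
have [e ew] := ex_ecc (parent v u).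
have [ne me] := (nmin _ _ ew, mmin _ _ ew).
have [[x xe] _] := ew.
have := dist_between x uv wv erefl; rewrite !(distC conn x) xe leq_max.
by case/orP; rewrite ltnNge => /negP; case; [apply: leq_trans (un x) ne|
  apply: leq_trans (vm x) me].
Qed.

Lemma center_cases v : (exists r, center G = [set r]) \/
  exists r s, adj r s /\ center G = [set r; s].
Proof.
have [r cr] := center_nonempty v.
have [[s [cs sr]]|ns] := EM (exists s, center G s /\ s <> r); last first.
  left; exists r; apply/seteqP; split=> x /=; last by move=> ->.
  by move=> cx; apply: contrapT => xr; apply: ns; exists x.
right; exists r, s.
have rs : adj r s by apply: center_adj => // /esym.
split=> //; apply/seteqP; split=> x /=; last by case=> ->.
move=> cx; have [xr|xr] := EM (x = r); first by left.
have [xs|xs] := EM (x = s); first by right.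
have xar := center_adj cx cr xr; have xas := center_adj cx cs xs.
(* Three central vertices would be pairwise adjacent and form a triangle. *)
case: sr; apply/esym; apply: (@branch_uniq G treeG x r s [:: s]) => //=.
  by rewrite rs.
by rewrite !inE negb_or; apply/andP; split; apply/eqP.
Qed.

Lemma center_automorphism f x : automorphism f -> center G x -> center G (f x).
Proof.
move=> autf [n [[w xw] xn] nmin]; exists n => //; split.
  by exists (f w); rewrite dist_automorphism.
have [g fK gK] := autf.1.
by move=> y; rewrite -(gK y) dist_automorphism.
Qed.

End Center.

Section FiniteTree.
Variables (G : sgraph) (treeG : is_tree G) (k : nat).
Hypothesis finG : finite_set [set: G].
Hypothesis k_gt1 : 1 < k.
Hypothesis degG : forall x : G, nbrs x #<= `I_k.+1.
Implicit Types r s x y : G.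

Let k_gt0 : 0 < k. Proof. exact: ltnW. Qed.

Let conn : connected_graph G := treeG.1.

Lemma leaf_perfect (chs : G -> seq G) x h : nbrs x #= `I_(size (chs x)).+1 ->
  perfect k chs h x -> leaf x -> h = 0.
Proof.
move=> nx; case: h => // h [sz _]; rewrite /leaf (card_eql nx) sz.
by move=> /card_eq_II[k0]; move: k_gt0; rewrite k0.
Qed.

Lemma inner_perfect (chs : G -> seq G) x h : nbrs x #= `I_(size (chs x)).+1 ->
  perfect k chs h x -> ~ leaf x -> nbrs x #= `I_k.+1.
Proof.
move=> nx; case: h => [|h] /=; last by case=> <-.
by move=> c0 []; rewrite c0 in nx.
Qed.

Lemma inner_regular_card :
  (forall x, ~ leaf x -> nbrs x #= `I_k.+1) -> inner_regular G.
Proof.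
move=> reg u v /reg nu /reg nv; rewrite (card_eql nu) card_eq_sym.
exact: nv.
Qed.

Lemma perfect_symmetric r (chs : G -> seq G) h : center G = [set r] ->
  (forall x y, (y \in chs x) = child (parent r) x y) ->
  (forall x, parent r x <> x -> nbrs x #= `I_(size (chs x)).+1) ->
  nbrs r #= `I_k.+1 -> {in chs r, forall y, perfect k chs h y} ->
  symmetric_tree G.
Proof.
move=> cr mem_chs nbx nbr per.
(* Depth plus remaining height is constant. The root is exempt: with k + 1 children it is not
   perfect itself. *)
have lev x : x = r \/ exists2 j, perfect k chs j x & dist r x + j = h.+1.
  elim/(depth_ind (parent_depth treeG (r := r))): x => x;
      rewrite parent_core //.
    by move=> /eqP; left.
  move=> xr IH; right; have /eqP xr' := xr.
  have xch : x \in chs (parent r x).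
    by rewrite mem_chs; apply/childP; rewrite parent_core.
  rewrite (dist_parent treeG xr'); case: IH => [pxr|[[|j] perp dj]].
  - by rewrite pxr in xch *; exists h; [exact: per|rewrite distxx].
  - by rewrite /= in perp; rewrite perp in xch.
  by exists j; [exact: perp.2|rewrite addSn -addnS].
have moved x : x <> r -> parent r x <> x.
  by move=> xr; apply: noncore_moved; rewrite parent_core //; apply/eqP.
have leafP x : leaf x -> dist r x = h.+1.
  move=> lx; have [xr|[j pj <-]] := lev x.
    move: lx; rewrite /leaf xr (card_eql nbr) => /card_eq_II[k0].
    by move: k_gt0; rewrite k0.
  have [xr|/moved/nbx nx] := EM (x = r).
    move: lx; rewrite /leaf xr (card_eql nbr) => /card_eq_II[k0].
    by move: k_gt0; rewrite k0.
  by rewrite (leaf_perfect nx pj lx) addn0.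
split=> //.
  apply: inner_regular_card => x nlx.
  have [->//|/moved/nbx nx] := EM (x = r).
  have [->//|[j pj _]] := lev x; exact: inner_perfect pj nlx.
by exists r; split=> // u w /leafP-> /leafP->.
Qed.

(** The step from x towards r also leads towards s. If s is farther from x than r, this is the
    triangle inequality; if s is nearer, the step towards s also leads towards r, so both steps
    coincide. *)
Lemma edge_parent_dist r s x : adj r s -> ~~ core (edge_parent r s) x ->
  minn (dist r x) (dist s x) =
  (minn (dist r (edge_parent r s x)) (dist s (edge_parent r s x))).+1.
Proof.
move=> rs; rewrite edge_parent_core // negb_or => /andP[/eqP xr /eqP xs].
rewrite /edge_parent; case: eqP => // _; set q := parent r x.
suff dsq : dist s x = (dist s q).+1.
  by rewrite dsq (dist_parent treeG xr) minnSS.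
have xq : adj x q := (parentP treeG xr).1.
have [psq|psq] := adj_parent treeG s xq; first exact: dist_parent_adj psq.
have drs : dist s x = (dist r x).+1 \/ dist r x = (dist s x).+1.
  rewrite !(distC conn _ x); have [prs|psr] := adj_parent treeG x rs.
    by right; exact: dist_parent_adj prs.
  by left; apply: dist_parent_adj psr => //; rewrite adj_sym.
have dr := dist_parent treeG xr; rewrite -/q in dr.
have ds : dist s q = (dist s x).+1.
  by apply: dist_parent_adj psq => //; rewrite adj_sym.
case: drs => d.
  have : dist s q <= (dist r q).+1.
    apply: leq_trans (dist_triangle conn s r q) _; rewrite -add1n leq_add2r.
    by apply: adj_dist1 => //; rewrite adj_sym.
  by rewrite ds d dr ltnNge leqW.
have xz := (parentP treeG xs).1; have dz := dist_parent treeG xs.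
suff -> : q = parent s x by [].
apply: parent_uniq => //.
apply: leq_trans (dist_triangle conn r s _) _; rewrite d dz -add1n.
apply: leq_add; last by rewrite leqnSn.
exact: adj_dist1.
Qed.

Lemma perfect_bisymmetric r s (chs : G -> seq G) h : adj r s ->
  center G = [set r; s] ->
  (forall x y, (y \in chs x) = child (edge_parent r s) x y) ->
  (forall x, nbrs x #= `I_(size (chs x)).+1) ->
  perfect k chs h r -> perfect k chs h s -> bisymmetric_tree G.
Proof.
move=> rs cr mem_chs nbx perr pers.
pose md x := minn (dist r x) (dist s x).
have lev x : exists2 j, perfect k chs j x & md x + j = h.
  elim/(depth_ind (edge_parent_depth treeG rs)): x => x.
    rewrite edge_parent_core // => /orP[]/eqP->; exists h => //;
      by rewrite /md distxx // ?min0n ?minn0.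
  move=> ncx [[|j] perp dj].
    have : x \in chs (edge_parent r s x) by rewrite mem_chs; exact/childP.
    by rewrite perp.
  exists j; last by rewrite -dj /md edge_parent_dist // addSn addnS.
  by apply: perp.2; rewrite mem_chs; exact/childP.
split=> //.
  apply: inner_regular_card => x nlx; have [j pj _] := lev x.
  exact: inner_perfect (nbx x) pj nlx.
have leafP x : leaf x -> md x = h.
  by move=> lx; have [j pj <-] := lev x;
      rewrite (leaf_perfect (nbx x) pj lx) addn0.
by exists r, s; split=> // u w /leafP + /leafP; rewrite /md => -> ->.
Qed.

Lemma finite_tree_colouring (C : eqType) (L : edges G ->
    set C) (a0 : C) (v : G) :
  (forall e, L e #= `I_k) ->
  [\/ symmetric_tree G, bisymmetric_tree G |
    exists c : edges G -> C, (forall e, L e (c e)) /\ distinguishing c].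
Proof.
move=> Lk; have [[r cr]|[r [s [rs crs]]]] := center_cases treeG finG v.
  have [N rN] := finite_dist_bound finG r.
  have orp := parent_orientation treeG r.
  have [chs [uchs mchs chsP chsr]] := ex_children orp degG.
  have [l lP] := ex_lists orp Lk.
  have fixr f : automorphism f -> f r = r.
    move=> autf; have : center G (f r).
      by apply: center_automorphism => //; rewrite cr.
    by rewrite cr.
  have chs_le x : parent r x <> x -> size (chs x) <= k by move=> /chsP[].
  have chs_le_r x : parent r x = x -> size (chs x) <= k.+1 by move=> /chsr[].
  have fcore f : automorphism f -> forall x, core (parent r) x ->
      f (parent r x) = parent r (f x).
    move=> autf x; rewrite parent_core // => /eqP->.
    by rewrite parent_root // fixr // parent_root.
  have [[h [szr per]]|] := root_colouring a0 k_gt0 orp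
      (parent_depth treeG (r := r)) rN uchs mchs chs_le chs_le_r lP fcore
      (parent_core treeG r) fixr (parent_root treeG r); last by constructor 3.
  constructor 1; apply: (perfect_symmetric cr mchs) per.
    by move=> x /chsP[].
  by have [_] := chsr r (parent_root treeG r); rewrite szr.
have [N rN] := finite_dist_bound finG r.
have orp := edge_parent_orientation treeG rs.
have [chs [uchs mchs chsP _]] := ex_children orp degG.
have [l lP] := ex_lists orp Lk.
have nrs := adj_neq rs.
have pr : edge_parent r s r = s by rewrite /edge_parent eqxx.
have ps : edge_parent r s s = r.
  by rewrite /edge_parent; case: eqP => [/esym//|_]; exact: parent_adj_root.
have coreE := edge_parent_core treeG rs.
have moved x : edge_parent r s x <> x.
  have [|/noncore_moved//] := boolP (core (edge_parent r s) x).
  by rewrite coreE => /orP[]/eqP->; rewrite ?pr ?ps // => /esym.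
have chs_le x : edge_parent r s x <> x -> size (chs x) <= k by move=> /chsP[].
have fixrs f : automorphism f -> f r = r /\ f s = s \/ f r = s /\ f s = r.
  move=> autf.
  have : center G (f r) by apply: center_automorphism => //; rewrite crs; left.
  have : center G (f s) by apply: center_automorphism => //; rewrite crs; right.
  have frs : f r <> f s by move=> /(bij_inj autf.1).
  by rewrite crs => -[] fs [] fr; [case: frs; rewrite fs fr|right|left|
    case: frs; rewrite fs fr].
have fcore f : automorphism f -> forall x, core (edge_parent r s) x ->
    f (edge_parent r s x) = edge_parent r s (f x).
  move=> autf x; rewrite coreE.
  by have [[fr fs]|[fr fs]] := fixrs f autf => /orP[]/eqP->;
    rewrite ?pr ?ps ?fr ?fs ?pr ?ps.
have [[h [perr pers]]|] := central_edge_colouring a0 k_gt0 orp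
  (edge_parent_depth treeG rs) rN uchs mchs chs_le lP fcore coreE ps pr nrs
  fixrs; last by constructor 3.
constructor 2; apply: (perfect_bisymmetric rs crs mchs _ perr pers) => x.
by have [] := chsP x (moved x).
Qed.

End FiniteTree.

(** * Trees oriented towards an end *)

Section EndOrientation.
Variables (G : sgraph) (k : nat) (C : eqType) (L : edges G -> set C).
Hypothesis k_gt1 : 1 < k.
Variables (q : G -> G) (v : nat -> G) (lev : G -> nat).
Hypothesis orq : orientation q.
Hypothesis noncore : forall x, ~~ core q x.
Hypothesis q_ray : forall i, q (v i) = v i.+1.
Hypothesis lev_ray : forall i, lev (v i) = i.
Hypothesis reach_ray : forall x, exists n i, iter n q x = v i.
Variables (chs : G -> seq G) (l : G -> seq C).
Hypothesis chs_uniq : forall x, uniq (chs x).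
Hypothesis mem_chs : forall x y, (y \in chs x) = child q x y.
Hypothesis size_chs : forall x, size (chs x) <= k.
Hypothesis l_uniq : forall x, uniq (l x).
Hypothesis size_l : forall x, size (l x) = k.
Hypothesis lP : forall x a, a \in l x -> vertex_list q L x a.
Variables (dec : nat -> G) (c0 : G -> C).
Hypothesis dec_surj : forall u, exists n, dec n = u.
Implicit Types (x y z u w : G) (col : G -> C).

Lemma ray_inj i j : v i = v j -> i = j.
Proof. by move=> vij; rewrite -(lev_ray i) vij lev_ray. Qed.

Lemma mem_chsE x y : (y \in chs x) = (q y == x).
Proof. by rewrite mem_chs /child noncore. Qed.

Lemma adj_q x : adj x (q x).
Proof. by apply: orq.1; exact: noncore_moved. Qed.

(** The colours of all edges at x, compared up to permutation. This is invariant even under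
    automorphisms that do not respect the orientation. *)
Definition star col x := col x :: map col (chs x).

Lemma eq_star col col' x : col' x = col x -> (forall y, q y = x ->
    col' y = col y) ->
  star col' x = star col x.
Proof.
move=> cx cy; rewrite /star cx; congr (_ :: _); apply/eq_in_map => y.
by rewrite mem_chsE => /eqP; exact: cy.
Qed.

Lemma star_automorphism col f x : automorphism f ->
  (forall x u, adj x u -> edge_col q col (f x) (f u) = edge_col q col x u) ->
  perm_eq (star col x) (star col (f x)).
Proof.
move=> autf colf; pose nb x := q x :: chs x.
have starE y : star col y = map (edge_col q col y) (nb y).
  rewrite /star /edge_col /= -/(core q y) (negPf (noncore y)); congr (_ :: _).
  by apply/eq_in_map => z; rewrite mem_chsE => ->.
have mem_nb y z : (z \in nb y) = adj y z.
  rewrite inE mem_chsE; apply/idP/idP => [/orP[/eqP->|/eqP<-]|/orq.2[->|->]].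
  - exact: adj_q.
  - by rewrite adj_sym adj_q.
  - by rewrite eqxx.
  by rewrite eqxx orbT.
have unb y : uniq (nb y).
  by rewrite /= chs_uniq mem_chsE andbT; exact: noncore.
have [g fK gK] := autf.1.
have fnb : perm_eq (map f (nb x)) (nb (f x)).
  apply: uniq_perm => //; first by rewrite map_inj_uniq //; exact: can_inj fK.
  move=> z; rewrite mem_nb -{2}(gK z) autf.2 -mem_nb -{1}(gK z) mem_map //.
  exact: can_inj fK.
rewrite !starE perm_sym; apply: perm_trans (perm_map _ (_ : perm_eq _ _)) _.
  by rewrite perm_sym; exact: fnb.
rewrite -map_comp; apply/permP => P; congr count; apply/eq_in_map => y.
by rewrite mem_nb => /colf.
Qed.

Definition valid := proper_at q l predT.

(* The child edges of such a vertex keep their colours from stage i on, since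
   stage j recolours only the child edges of v j.+1. *)
Definition settled i x := forall j, i < j -> x <> v j.

(* The colours at w and at the children of v i being given, at most one colour
   of the edge from v i to v i.+1 makes the two multisets of colours agree. *)
Lemma recolour_ray col i w : valid col -> settled i w -> settled i (q w) ->
  exists col', [/\ valid col', forall x, q x <> v i.+1 -> col' x = col x &
    ~~ perm_eq (star col' (v i)) (star col' w)].
Proof.
move=> vcol wi qwi; have [colL colI] := vcol.
have [pe|npe] := boolP (perm_eq (star col (v i)) (star col w));
    last by exists col.
have /hasP[b bl nb] : has (fun b => b != col (v i)) (l (v i)).
  apply: contraLR k_gt1; rewrite -all_predC => /allP allb.
  rewrite -leqNgt -(size_l (v i)).
  apply: (@uniq_leq_size _ _ [:: col (v i)]) => // b /allb /=.
  by rewrite negbK inE.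
have vch : v i \in chs (v i.+1) by rewrite mem_chsE q_ray.
pose s := rem (v i) (chs (v i.+1)).
have us : uniq s by exact: rem_uniq.
(* The at most k - 1 siblings of [v i] are recoloured to avoid the new colour b. *)
have [||g [gl gI]] := @distinct_representatives _ _ k l col s [:: b] us.
- by move=> x _; split.
- by rewrite /s size_rem // addn1 prednK ?size_chs //; case: (chs _) vch.
have memS x : q x = v i.+1 -> x <> v i -> x \in s.
  by move=> qx /eqP xv; rewrite mem_rem_uniq // inE xv mem_chsE qx /=.
pose col' x := if q x == v i.+1 then if x == v i then b else g x else col x.
have col'E x : q x <> v i.+1 -> col' x = col x by rewrite /col' => /eqP/negPf->.
have vvS : v i <> v i.+1 by move=> /ray_inj/eqP;
    rewrite -[i.+1]addn1 -{1}[i]addn0 eqn_add2l.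
have starw : star col' w = star col w.
  apply: eq_star => [|y qy]; apply: col'E; first by apply: qwi.
  by rewrite qy; apply: wi.
have starv : star col' (v i) = b :: map col (chs (v i)).
  rewrite /star {1}/col' q_ray !eqxx; congr (_ :: _); apply/eq_in_map => y.
  by rewrite mem_chsE => /eqP qy; apply: col'E; rewrite qy.
exists col'; split=> //.
- split=> [x _|x y ncx ncy qxy _].
    rewrite /col'; case: eqP => [qx|_]; last exact: colL.
    case: eqP => [->//|xv]; by have /andP[] := gl x (memS x qx xv).
  have gb z : z \in s -> g z <> b.
    by move=> /gl/andP[_]; rewrite inE => /eqP.
  rewrite /col' -qxy; case: eqP => [qx|_]; last by move=> cxy; exact: colI.
  have qy : q y = v i.+1 by rewrite -qxy.
  case: eqP => [->|xv]; case: eqP => [->//|yv].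
  + by move=> /esym/gb; case; exact: memS.
  + by move=> /gb; case; exact: memS.
  by apply: gI; exact: memS.
rewrite starw starv; apply/negP => pe'.
(* Both versions of the star at [v i] would be permutations of the star at w; counting b shows that
   b is the old colour. *)
have : perm_eq (b :: map col (chs (v i))) (star col (v i)).
  by apply: perm_trans pe' _; rewrite perm_sym.
move=> /permP/(_ (pred1 b)); rewrite /= eqxx => /eqP.
by rewrite eqn_add2r [col _ == b]eq_sym (negPf nb).
Qed.

Section Diagonal.
Variable target : nat -> (G -> C) -> G.

(** The target of stage n may depend on the colouring [cs n] reached so far. Each edge is recoloured
    at most once, so a limit colouring exists, and stars separated at stage n stay separated. *)
Lemma ex_diagonal : exists (cs : nat -> G -> C) (col : G -> C), [/\ valid col,
  forall n, valid (cs n),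
  forall x n, settled n (q x) -> cs n x = col x &
  forall n, settled n (target n (cs n)) -> settled n (q (target n (cs n))) ->
    ~~ perm_eq (star col (v n)) (star col (target n (cs n)))].
Proof.
have step (ic : nat * (G -> C)) : exists col', valid ic.2 -> [/\ valid col',
    forall x, q x <> v ic.1.+1 -> col' x = ic.2 x &
    settled ic.1 (target ic.1 ic.2) -> settled ic.1 (q (target ic.1 ic.2)) ->
    ~~ perm_eq (star col' (v ic.1)) (star col' (target ic.1 ic.2))].
  case: ic => i col /=; have [vcol|] := EM (valid col); last by exists col.
  have [[wi qwi]|nst] :=
      EM (settled i (target i col) /\ settled i (q (target i col))).
    by have [col' [? ? ?]] := recolour_ray vcol wi qwi; exists col'.
  by exists col => _; split=> // wi qwi; case: nst.
have {step} [stepf stepP] := choice step.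
have [||base vbase _] := ex_proper chs_uniq mem_chs (fun x _ => l_uniq x)
  (fun x _ => size_l x) (D := predT) (c0 := c0).
- by [].
- by [].
pose cs := fix cs n := if n is n'.+1 then stepf (n', cs n') else base.
have vcs n : valid (cs n).
  by elim: n => [//|n IH]; have [] := stepP (n, cs n) IH.
have csS n x : q x <> v n.+1 -> cs n.+1 x = cs n x.
  by move=> qx; have [_ + _] := stepP (n, cs n) (vcs n); apply.
(* If [q x = v j], the colour of x is final from [cs j] on; if [q x] is off the ray, it never
   changes. *)
pose col x := cs (lev (q x)) x.
have csE x n : settled n (q x) -> cs n x = col x.
  move=> st; rewrite /col; have [[j qx]|nray] := EM (exists j, q x = v j).
    rewrite qx lev_ray; have jn : j <= n.
      by rewrite leqNgt; apply/negP => /st; rewrite qx.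
    rewrite -(subnKC jn); elim: (n - j) => [|m IH]; first by rewrite addn0.
    rewrite addnS csS // qx => /ray_inj/eqP.
    by rewrite ltn_eqF // ltnS leq_addr.
  have cs0 m : cs m x = cs 0 x.
    by elim: m => // m <-; apply: csS => qx; apply: nray; exists m.+1.
  by rewrite cs0 [in RHS]cs0.
exists cs, col; split=> //.
  split=> [x ncx|x y ncx ncy qxy _]; first exact: (vcs _).1.
  by rewrite /col qxy; exact: (vcs _).2.
move=> n wn qwn; have [_ _ /(_ wn qwn)] := stepP (n, cs n) (vcs n).
rewrite -/(cs n.+1) /=.
have settledS x : settled n x -> settled n.+1 x.
  by move=> st j /ltnW/st.
rewrite !(@eq_star col (cs n.+1)) //.
- by apply: csE; exact: settledS.
- by move=> y qy; apply: csE; rewrite qy; exact: settledS.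
- by apply: csE => j jn; rewrite q_ray => /ray_inj nj; rewrite nj ltnn in jn.
move=> y qy; apply: csE => j jn; rewrite qy => /ray_inj nj.
by rewrite nj ltnNge leqnSn in jn.
Qed.

End Diagonal.

(** Follows the word s downwards from u. In a valid colouring the child is determined by its colour;
    without such a child, [xget] stays in place. *)
Definition walk col u (s : seq C) :=
  foldl (fun u a => xget u [set y | q y = u /\ col y = a]) u s.

(* Stage m serves the requirement coded by m: for t > 0 the translation of the
   ray by t, for t = 0 the automorphisms that send v j to u = dec n and then
   lead the ray away from its end, the image of v m being found by reading
   the colours of the ray downwards from u. *)
Definition diagonal_target m col : G :=
  if @unpickle (nat * nat * nat * nat)%type m is Some (t, j, n, _) then
    if t is 0 then walk col (dec n) (map (fun i => col (v i)) (iota j (m - j)))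
    else v (m - t)
  else v 0.

(** The last component of the code is padding: it gives every requirement infinitely many codes,
    hence arbitrarily late stages. *)
Lemma requirement_late (t j n M : nat) :
  exists m, M <= m /\ exists b : nat,
    @unpickle (nat * nat * nat * nat)%type m = Some (t, j, n, b).
Proof.
have [|b Mb] := @injective_gtn (fun b : nat => pickle (t, j, n, b)) _ M.
  by move=> b b' /(pcan_inj pickleK) [].
by exists (pickle (t, j, n, b)); rewrite ltnW //; split=> //; exists b;
    rewrite pickleK.
Qed.

(** A colour preserving f cannot lead the ray away from its end, so it eventually acts on the ray as
    a translation. Nonzero translations are excluded, so f fixes a tail of the ray and then
    everything below it. *)
Lemma end_colouring :
  exists c : edges G -> C, (forall e, L e (c e)) /\ distinguishing c.
Proof.
have [cs [col [vcol vcs csE kill]]] := ex_diagonal diagonal_target.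
apply: (colouring_of_vertices orq (col := col)).
- by move=> x _; apply: lP; apply: vcol.1; exact: noncore.
- by move=> x; rewrite (negPf (noncore x)).
move=> f autf colf.
have f_inj := bij_inj autf.1.
have fstar x := star_automorphism x autf colf.
have killt t M : 0 < t -> exists2 i, M <= i &
    ~~ perm_eq (star col (v (i + t))) (star col (v i)).
  case: t => // t _;
      have [m [Mm [b mE]]] := requirement_late t.+1 0 0 (M + t.+1).
  have tm : t.+1 <= m by apply: leq_trans Mm; rewrite leq_addl.
  exists (m - t.+1); first by rewrite leq_subRL // addnC.
  rewrite subnK //; have := kill m; rewrite /diagonal_target mE; apply.
    move=> j mj /ray_inj jE; move: mj; rewrite -jE.
    by rewrite ltnNge leq_subr.
  move=> j mj; rewrite q_ray => /ray_inj jE; move: mj; rewrite -jE.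
  by rewrite ltnNge -subSn // subSS leq_subr.
have fadj i : q (f (v i)) = f (v i.+1) \/ q (f (v i.+1)) = f (v i).
  by apply: orq.2; rewrite autf.2 -q_ray adj_q.
(* If the image of the ray descends once, it descends forever: turning upwards would identify the
   images of two vertices of the ray. *)
have asc i : q (f (v i)) = f (v i.+1).
  apply: contrapT => /(_ _)/= nasc.
  have : q (f (v i.+1)) = f (v i) by case: (fadj i).
  move: i {nasc} => j desc0.
  have desc n : q (f (v (j + n).+1)) = f (v (j + n)).
    elim: n => [|n IH]; first by rewrite addn0.
    have [asc|//] := fadj (j + n.+1).
    move: asc; rewrite addnS IH => /f_inj/ray_inj/eqP.
    by rewrite -[X in X == _]addn0 -addn2 eqn_add2l.
  have descn n : iter n q (f (v (j + n))) = f (v j).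
    by elim: n => [|n IH]; rewrite ?addn0 // addnS iterSr desc.
  have [n nE] := dec_surj (f (v j)).
  have [m [Mm [b mE]]] := requirement_late 0 j n (maxn j.+1 (lev (f (v j)))).
  move: Mm; rewrite geq_max => /andP[jm um].
  (* Otherwise climbing i steps from [v a] with [a > m] would reach [f (v j)] at level [i + a],
     beyond the bound built into m. *)
  have off i : settled m (f (v (j + i))).
    move=> a ma fva; have := descn i; rewrite fva.
    have -> : iter i q (v a) = v (i + a).
      by elim: i {fva} => //= i ->; rewrite q_ray.
    move=> uE; move: um; rewrite -uE lev_ray leqNgt.
    by rewrite (leq_trans ma) // leq_addl.
  (* The edges involved already have their final colours at stage m, and f preserves those; so
     reading the colours of the ray from [f (v j)] traces its image. *)
  have walkE i : j + i <= m ->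
      walk (cs m) (f (v j)) (map (fun i => cs m (v i)) (iota j i)) = f (v (j +
          i)).
    elim: i => [|i IH] im; first by rewrite addn0.
    have im' : j + i < m by rewrite -addnS.
    have -> : iota j i.+1 = rcons (iota j i) (j + i) by rewrite -addn1 iotaD
        cats1.
    rewrite map_rcons /walk foldl_rcons -[foldl _ _ _]/(walk _ _ _) IH ?(ltnW
        im') //.
    rewrite addnS.
    have uP : q (f (v (j + i).+1)) = f (v (j + i)) /\
        cs m (f (v (j + i).+1)) = cs m (v (j + i)).
      split; first exact: desc.
      rewrite !csE; first last.
      - by rewrite desc; exact: off.
      - by move=> a ma; rewrite q_ray => /ray_inj aE; move: ma;
          rewrite -aE ltnNge im'.
      have := colf (v (j + i)) (v (j + i).+1); rewrite -q_ray adj_q => /(_ isT).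
      rewrite q_ray /edge_col desc eqxx q_ray.
      by case: eqP => // /ray_inj/eqP;
          rewrite -[X in _ == X]addn0 -addn2 eqn_add2l.
    apply: (@xget_unique _ _ [set y | q y = f (v (j + i)) /\ cs m y = cs m (v
        (j + i))]).
      exact: uP.
    move=> y [qy cy]; apply: (vcs m).2 => //; first by rewrite uP.1.
    by rewrite uP.2.
  have wE : diagonal_target m (cs m) = f (v m).
    by rewrite /diagonal_target mE nE walkE subnKC // ltnW.
  have := kill m; rewrite wE fstar => /(_ _ _)/negP; apply=> //.
    by have := off (m - j); rewrite subnKC // ltnW.
  have := off (m - j.+1); rewrite -desc -addSn subnKC //.
have [n [a fa]] := reach_ray (f (v 0)).
have fray i : f (v (n + i)) = v (a + i).
  elim: i => [|i IH]; last by rewrite !addnS -asc IH q_ray.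
  rewrite !addn0 -fa; elim: (n) => //= m <-; by rewrite asc.
(* If a and n differ, f translates the tail by their difference, against [killt]. *)
have fixn i : n <= i -> f (v i) = v i.
  move=> ni; have [an|na|E] := ltngtP a n; last by rewrite -(subnKC ni) fray E.
  - have [|i' ai' /negP] := killt (n - a) a; first by rewrite subn_gt0.
    case; apply: perm_trans (fstar _) _.
    have -> : i' + (n - a) = n + (i' - a).
      by rewrite addnBA ?(ltnW an) // addnBA // addnC.
    by rewrite fray subnKC.
  have [|i' ni' /negP] := killt (a - n) n; first by rewrite subn_gt0.
  case; rewrite perm_sym; apply: perm_trans (fstar _) _.
  rewrite -{1}(subnKC ni') fray.
  have -> // : a + (i' - n) = i' + (a - n).
  by rewrite addnBA // addnBA ?(ltnW na) // addnC.
suff fixq m : forall x i, n <= i -> iter m q x = v i -> f x = x.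
  move=> x; have [m [i xi]] := reach_ray x.
  apply: (fixq (n + m) x (n + i)); first exact: leq_addr.
  rewrite iterD xi; elim: (n) => //= n' ->; by rewrite q_ray.
elim: m => [|m IH] x i ni; first by rewrite /= => ->; exact: fixn.
rewrite iterSr => xi; have fq := IH (q x) i ni xi.
(* Since [q (q x)] is fixed too, f x is another neighbour of [q x], hence a child of it with the
   colour of x. *)
have fqq : f (q (q x)) = q (q x).
  by apply: (IH _ i.+1); [exact: leqW|rewrite -iterSr iterS xi q_ray].
have fx : q (f x) = q x.
  have : adj (f x) (f (q x)) by rewrite autf.2 adj_q.
  case/orq.2; rewrite fq // -fqq => /f_inj qqx.
  by case/negP: (noncore x); rewrite /core qqx.
apply: vcol.2 => //; have := colf (q x) x; rewrite adj_sym adj_q => /(_ isT).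
by rewrite fq -{1}fx !edge_col_parent.
Qed.

End EndOrientation.

(** * Infinite locally finite trees *)

Section InfiniteTree.
Variables (G : sgraph) (treeG : is_tree G) (k : nat).
Hypothesis infG : infinite_set [set: G].
Hypothesis k_gt1 : 1 < k.
Hypothesis degG : forall x : G, nbrs x #<= `I_k.+1.
Variable r : G.
Implicit Types x y z : G.

Let conn : connected_graph G := treeG.1.
Let p := parent r.
Let orp : orientation p := parent_orientation treeG r.

Definition subtree x : set G := [set y | exists n, iter n (parent r) y = x].

Lemma subtree_root : subtree r = [set: G].
Proof.
apply/seteqP; split=> // x _; elim/(depth_ind (parent_depth treeG (r := r))): x.
  by move=> x; rewrite parent_core // => /eqP->; exists 0.
by move=> x _ [n xn]; exists n.+1; rewrite iterSr.
Qed.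

Lemma subtree_child x z : subtree x z ->
    z = x \/ exists2 y, child p x y & subtree y z.
Proof.
case=> n; elim: n x => [|n IH] x /=; first by left.
move=> znx; have [cy|ncy] := boolP (core p (iter n (parent r) z)); last first.
  by right; exists (iter n (parent r) z); [apply/childP|exists n].
move: (cy); rewrite /p parent_core // => /eqP zr; apply: IH.
by rewrite -znx zr parent_root.
Qed.

(** The pigeonhole step of König's lemma: x has only finitely many children. *)
Lemma konig_step x : infinite_set (subtree x) ->
  exists2 y, child p x y & infinite_set (subtree y).
Proof.
move=> infx; apply: contrapT => nex.
have [chs [_ mchs _ _]] := ex_children orp degG.
apply: infx;
    apply: (@sub_finite_set _ _ ([set x] `|` \bigcup_(y in [set` chs x])
        subtree y)).
  move=> z /subtree_child[->|[y xy yz]]; first by left.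
  by right; exists y => //=; rewrite mchs.
rewrite finite_setU; split; first exact: finite_set1.
apply: bigcup_finite; first exact: finite_seq.
move=> y /=; rewrite mchs => xy; apply: contrapT => infy.
by apply: nex; exists y.
Qed.

Lemma ex_ray : exists v : nat -> G, v 0 = r /\ forall n, child p (v n) (v n.+1).
Proof.
pose next x := xget x [set y | child p x y /\ infinite_set (subtree y)].
have nextP x : infinite_set (subtree x) ->
    child p x (next x) /\ infinite_set (subtree (next x)).
  move=> /konig_step[y xy yi].
  exact: (@xgetPex _ x [set y | child p x y /\ infinite_set (subtree y)]
    (ex_intro _ y (conj xy yi))).
have inf n : infinite_set (subtree (iter n next r)).
  by elim: n => [|n IH] /=; [rewrite subtree_root|case: (nextP _ IH)].
by exists (fun n => iter n next r); split=> // n; case: (nextP _ (inf n)).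
Qed.

(** Spheres around r are finite. The enumeration lists the possible images of a ray vertex in
    [end_colouring]. *)
Lemma countable_vertices : exists dec : nat -> G, forall u, exists n, dec n = u.
Proof.
pose sphere n : set G := [set x | dist r x = n].
have [chs [_ mchs _ _]] := ex_children orp degG.
have finS n : finite_set (sphere n).
  elim: n => [|n IH].
    apply: (@sub_finite_set _ _ [set r]); last exact: finite_set1.
    by move=> x /= /(dist0_eq conn).
  apply: (@sub_finite_set _ _ (\bigcup_(y in sphere n) [set` chs y])).
    rewrite /sphere => x /= xn.
    have xr : x <> r by move=> xr; rewrite xr distxx in xn.
    exists (parent r x) => /=.
      by move: xn; rewrite (dist_parent treeG xr) => -[].
    by rewrite mchs; apply/childP; rewrite /p parent_core //; split=> //;
        apply/eqP.
  by apply: bigcup_finite => // y _; exact: finite_seq.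
have : countable [set: G].
  have -> : [set: G] = \bigcup_(n in [set: nat]) sphere n.
    by apply/seteqP; split=> // x _; exists (dist r x).
  by apply: bigcup_countable => // n _; exact: finite_set_countable.
move=> /countable_injP[g ginj].
exists (fun n => xget r [set u | g u = n]) => u; exists (g u).
by apply: xget_unique => // y /= gy; apply: ginj; rewrite ?inE.
Qed.

Lemma infinite_tree_colouring (C : eqType) (L : edges G -> set C) (a0 : C) :
  (forall e, L e #= `I_k) ->
  exists c : edges G -> C, (forall e, L e (c e)) /\ distinguishing c.
Proof.
move=> Lk; have [v [v0 vP]] := ex_ray.
have dv n : dist r (v n) = n.
  elim: n => [|n IH]; first by rewrite v0 distxx.
  by have /childP[ncv pv] := vP n; rewrite parent_depth // -/p pv IH.
have vinj i j : v i = v j -> i = j by move=> vij; rewrite -(dv i) vij dv.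
(* The ray starts at the root, so reversing just its edges turns the orientation towards r into one
   towards the end of the ray. *)
pose q x := if x == v (dist r x) then v (dist r x).+1 else p x.
have q_ray i : q (v i) = v i.+1 by rewrite /q dv eqxx.
have q_off x : (forall i, x <> v i) -> q x = p x.
  by rewrite /q; case: eqP => // xv /(_ _ xv).
have ray x : (exists i, x = v i) \/ (forall i, x <> v i).
  have [?|nx] := EM (exists i, x = v i); first by left.
  by right=> i xi; apply: nx; exists i.
have nr x : (forall i, x <> v i) -> x <> r by rewrite -v0; exact.
have pv i : p (v i.+1) = v i by have /childP[] := vP i.
have orq : orientation q.
  split=> [x qx|x y xy].
    have [[i xi]|/[dup] xoff /q_off qp] := ray x.
      by rewrite xi q_ray; exact: child_adj orp _ _ (vP i).
    by rewrite qp; apply: orp.1; rewrite -qp.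
  wlog pxy : x y xy / p x = y.
    move=> wl; have [pxy|pyx] := orp.2 _ _ xy; first exact: wl.
    by apply/or_comm; apply: wl => //; rewrite adj_sym.
  have [[[|i] xi]|/q_off qp] := ray x; last by left; rewrite qp.
    by move: xy; rewrite -pxy xi v0 /p (parent_root treeG) adj_irr.
  by right; rewrite -pxy xi pv q_ray.
have noncore x : ~~ core q x.
  apply/eqP; have [[i xi]|xoff] := ray x.
    rewrite xi !q_ray => /vinj/eqP.
    by rewrite -addn2 -[X in _ == X]addn0 eqn_add2l.
  rewrite (q_off _ xoff); have [[i pxi]|poff] := ray (p x).
    by rewrite pxi q_ray => /esym/xoff.
  rewrite (q_off _ poff) => ppx; have := parent_core treeG r x.
  rewrite /core -/p ppx eqxx => /esym/eqP; exact: nr.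
have reach x : exists n i, iter n q x = v i.
  elim/(depth_ind (parent_depth treeG (r := r))): x => x.
    by rewrite parent_core // => /eqP->; exists 0, 0.
  move=> _ [n [i ni]]; have [[j xj]|xoff] := ray x; first by exists 0, j.
  by exists n.+1, i; rewrite iterSr q_off.
have [chs [uchs mchs chsP _]] := ex_children orq degG.
have [l lP] := ex_lists orq Lk.
have moved x : q x <> x by exact: noncore_moved.
have [dec decP] := countable_vertices.
apply: (@end_colouring G k C L k_gt1 q v (dist r) orq noncore q_ray dv reach
  chs l uchs mchs _ _ _ _ dec (fun=> a0) decP) => x.
- by have [] := chsP x (moved x).
- by have [] := lP x (moved x).
- by have [] := lP x (moved x).
by move=> a; have [_ _ lx] := lP x (moved x); move/lx.
Qed.

End InfiniteTree.

(** * Trees of infinite degree *)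

Section InfiniteRepresentatives.

Lemma card_leI (T U : Type) (A : set T) (B : set U) (f : T -> U) :
  (forall x, A x -> B (f x)) ->
  (forall x y, A x -> A y -> f x = f y -> x = y) -> A #<= B.
Proof.
move=> fAB fI;
    have /injfunPex[g] : exists2 g : T -> U, set_fun A B g & set_inj A g.
  by exists f => // x y; rewrite !inE; exact: fI.
exact: inj_card_le g.
Qed.

Lemma card_leE (T U : Type) (A : set T) (B : set U) (u0 : U) : A #<= B ->
  exists f : T -> U, (forall x, A x -> B (f x)) /\
    (forall x y, A x -> A y -> f x = f y -> x = y).
Proof.
elim/Ppointed: U => U in B u0 *; first by case: (no u0).
move=> /pcard_leP/injfunPex[f fAB fI]; exists f; split=> // x y Ax Ay.
by apply: fI; rewrite inE.
Qed.

(** Hilbert's hotel: along a sequence h in the difference, F moves to the even places and the terms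
    of h move to the odd ones; all else stays. *)
Lemma card_le_infinite_setD (T : Type) (A F : set T) : infinite_set A ->
  finite_set F -> A #<= A `\` F.
Proof.
move=> infA finF; have infD := infinite_setD infA finF.
have [a0 _] := infinite_setN0 infA.
have [h [hD hI]] := card_leE a0 ((infiniteP (A `\` F)).1 infD).
have [e [_ eI]] := card_leE 0 (finite_set_countable finF).
have {hI} hI m n : h m = h n -> m = n by exact: hI.
have {hD} hD n : (A `\` F) (h n) by exact: hD.
pose inv x := xget 0 [set n | h n = x].
have invK n : inv (h n) = n.
  by apply: xget_unique => // m /hI.
pose g x := if `[< F x >] then h (e x).*2
  else if `[< exists n, h n = x >] then h (inv x).*2.+1 else x.
apply: (@card_leI _ _ _ _ g) => [x Ax|x y Ax Ay].
  rewrite /g; case: asboolP => Fx; first exact: hD.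
  by case: asboolP => hx; [exact: hD|split].
have neq m n : m.*2 <> n.*2.+1 by move=> /(congr1 odd); rewrite /= !odd_double.
rewrite /g; case: (asboolP (F x)) => Fx; case: (asboolP (F y)) => Fy.
- by move=> /hI/double_inj/eI; exact.
- case: asboolP => [[n ny]|nhy]; first by move=> /hI/neq.
  by move=> hy; case: nhy; eexists; exact: hy.
- case: asboolP => [[n ny]|nhx]; first by move=> /hI/esym/neq.
  by move=> /esym hx; case: nhx; eexists; exact: hx.
case: asboolP => [[m <-]|nhx]; case: asboolP => [[n <-]|nhy] //.
- by rewrite !invK => /hI/succn_inj/double_inj ->.
- by move=> hy; case: nhy; eexists; exact: hy.
by move=> /esym hx; case: nhx; eexists; exact: hx.
Qed.

Lemma well_order_total (T : eqType) (R : rel T) : well_order R ->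
  antisymmetric R /\ total R.
Proof.
move=> Rwo; have RwoT : wo_chain R predT by exact: withinW.
by split=> x y; [exact: (wo_chain_antisymmetric RwoT)|exact: (wo_chainW RwoT)].
Qed.

Lemma well_order_min (T : eqType) (R : rel T) (P : set T) : well_order R ->
  P !=set0 -> exists2 z, P z & forall x, P x -> R z x.
Proof.
move=> Rwo [x Px]; have [|z [[Pz zmin] _]] := Rwo [pred z | `[< P z >]].
  by exists x; apply/asboolP.
exists z; first exact/asboolP.
by move=> y Py; apply: zmin; apply/asboolP.
Qed.

Lemma well_order_wf (T : eqType) (R : rel T) : well_order R ->
  well_founded (fun x y => R x y && (x != y)).
Proof.
move=> Rwo x; apply: contrapT => nax.
have [|z naz zmin] := @well_order_min T R
    [set z | ~ Acc (fun x y => R x y && (x != y)) z] Rwo; first by exists x.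
apply: naz; constructor=> y /andP[yz /eqP nyz]; apply: contrapT => nay.
by apply: nyz; apply: (well_order_total Rwo).1; rewrite yz zmin.
Qed.

(* The set S is the shortest initial segment of a well-ordering of A that has
   the size of A. *)
Lemma ex_initial_order (T : eqType) (A : set T) :
  exists (lt : T -> T -> Prop) (S : set T),
  [/\ well_founded lt, forall x y, [\/ lt x y, x = y | lt y x],
      A #<= S & forall s, S s -> ~ (A #<= [set t | S t /\ lt t s])].
Proof.
have [R Rwo] := well_ordering_principle T.
have [anti tot] := well_order_total Rwo.
pose lt x y : Prop := R x y && (x != y).
have ltT x y : [\/ lt x y, x = y | lt y x].
  have [->|xy] := eqVneq x y; first by constructor 2.
  have /orP[xRy|yRx] := tot x y; first by constructor 1; rewrite /lt xRy.
  by constructor 3; rewrite /lt yRx eq_sym.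
have wf : well_founded lt by exact: well_order_wf.
pose bad s := A s /\ A #<= [set t | A t /\ lt t s].
have [exbad|nbad] := EM (bad !=set0); last first.
  exists lt, A; split=> // s As As'.
  by apply: nbad; exists s.
have [z [Az zbad] zmin] := well_order_min Rwo exbad.
exists lt, [set t | A t /\ lt t z]; split=> // s [As /andP[sz nsz]] sbad.
case/eqP: nsz; apply: anti; rewrite sz /=; apply: zmin; split=> //.
by apply: card_le_trans sbad _; apply: subset_card_le => t [[]].
Qed.

(** Transfinite recursion along an order whose proper initial segments are smaller than D: the
    colours used before y are too few to exhaust the list of y, even with F removed. *)
Lemma infinite_representatives (V : Type) (C : choiceType) (T : eqType) (D :
    set T)
    (l : V -> set C) (c0 : V -> C) (I : set V) (F : set C) :
  infinite_set D -> I #<= D -> (forall y, I y -> D #<= l y) -> finite_set F ->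
  exists col : V -> C, (forall y, I y -> l y (col y) /\ ~ F (col y)) /\
    (forall y z, I y -> I z -> col y = col z -> y = z).
Proof.
move=> infD ID lD finF; have [d0 _] := infinite_setN0 infD.
have [lt [S [wf tot DS segS]]] := ex_initial_order D.
have [phi [phiS phiI]] := card_leE d0 (card_le_trans ID DS).
pose R y z := lt (phi y) (phi z).
have wfR : well_founded R.
  suff acc t : Acc lt t -> forall y, phi y = t -> Acc R y.
    by move=> y; exact: acc (wf (phi y)) y erefl.
  elim=> {}t _ IH y yt; constructor=> z zy.
  by apply: (IH (phi z)) => //; rewrite -yt.
pose step y (rec : forall z, R z y -> C) : C :=
  xget (c0 y) [set c | [/\ l y c, ~ F c & forall z (h : R z y), I z ->
      rec z h <> c]].
pose col := Fix wfR (fun=> C) step.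
have colE y : col y = step y (fun z _ => col z).
  apply: (Fix_eq wfR (fun=> C) step) => x f g fg; congr (step x _).
  by apply: functional_extensionality_dep => z;
      exact: functional_extensionality_dep.
have colP y : I y -> [/\ l y (col y), ~ F (col y) &
    forall z, R z y -> I z -> col z <> col y].
  move=> Iy; rewrite colE /step.
  set P := (X in xget _ X).
  suff /(xgetPex (c0 y)) : exists c, P c by [].
  (* If no colour were left, D would embed in the segment below [phi y]. *)
  apply: contrapT => nP; apply: (segS (phi y)); first exact: phiS.
  have infl : infinite_set (l y).
    by move=> finl; apply: infD; exact: card_le_finite (lD y Iy) finl.
  apply: card_le_trans (lD y Iy) _.
  apply: card_le_trans (card_le_infinite_setD infl finF) _.
  apply: (@card_le_trans _ _ _ (col @` [set z | I z /\ R z y])).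
    apply: subset_card_le => c [lc Fc]; apply: contrapT => nc; apply: nP.
    by exists c; split=> // z zy Iz cz; apply: nc; exists z.
  apply: card_le_trans (card_image_le _ _) _.
  apply: (@card_leI _ _ _ _ phi) => [z [Iz zy]|z z' [Iz _] [Iz' _]].
    by split=> //; exact: phiS.
  exact: phiI.
exists col; split=> [y /colP[]//|y z Iy Iz cyz].
have [yz|/phiI|zy] := tot (phi y) (phi z).
- by have [_ _ /(_ y yz Iy)] := colP z Iz.
- exact.
by have [_ _ /(_ z zy Iz)] := colP y Iy; rewrite cyz.
Qed.

End InfiniteRepresentatives.

(* The colour a occurs only on the edge rs and the colour b only on rt. *)
Lemma infinite_degree_colouring (G : sgraph) (T : eqType) (D : set T)
    (C : choiceType) (L : edges G -> set C) (r s t : G) :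
  is_tree G -> infinite_set D -> (forall x : G, nbrs x #<= D) ->
  (forall e, L e #= D) -> adj r s -> adj r t -> t <> s ->
  exists c : edges G -> C, (forall e, L e (c e)) /\ distinguishing c.
Proof.
move=> treeG infD degG LD rs rt ts; pose p := edge_parent r s.
have orp : orientation p := edge_parent_orientation treeG rs.
have coreE x : core p x = (x == r) || (x == s) := edge_parent_core treeG rs x.
have dpP := edge_parent_depth treeG rs.
have pr : p r = s by rewrite /p /edge_parent eqxx.
have ps : p s = r.
  rewrite /p /edge_parent; case: eqP => [sr|_]; last exact: parent_adj_root.
  by case: (adj_neq rs).
have cr : core p r by rewrite coreE eqxx.
have cs : core p s by rewrite coreE eqxx orbT.
have tr : t <> r by move=> tr; case: (adj_neq rt).
have nct : ~~ core p t by rewrite coreE negb_or; apply/andP; split; apply/eqP.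
have pt : p t = r.
  by rewrite /p /edge_parent; case: eqP => // _; exact: parent_adj_root.
have moved x : p x <> x.
  have [|/noncore_moved//] := boolP (core p x).
  rewrite coreE => /orP[]/eqP->; rewrite ?pr ?ps; last exact: adj_neq.
  by move=> /esym; exact: adj_neq.
have vD x : vertex_list p L x #= D.
  by have [e ->] := vertex_listE orp L (moved x).
have vinf x (F : set C) : finite_set F ->
    exists a, vertex_list p L x a /\ ~ F a.
  move=> finF; have [|a [? ?]] := @infinite_setN0 _ (vertex_list p L x `\` F).
    apply: infinite_setD => // fin; apply: infD.
    by rewrite -(eq_finite_set (vD x)).
  by exists a.
have [a [ar _]] := vinf r set0 (finite_set0 _).
have a_s : vertex_list p L s a.
  by move=> e; rewrite ps setUC -pr => ve; exact: ar.
have [b [bt ba]] := vinf t [set a] (finite_set1 a).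
have loc x : exists g : G -> C,
    (forall y, child p x y -> vertex_list p L y (g y) /\ ~ [set a; b] (g y)) /\
    (forall y z, child p x y -> child p x z -> g y = g z -> y = z).
  apply: (@infinite_representatives G C T D (vertex_list p L) (fun=> a)
    [set y | child p x y] [set a; b]) => //.
  - by apply: card_le_trans (degG x);
      apply: subset_card_le => y /(child_adj orp).
  - by move=> y _; rewrite (card_le_eqr (vD y)).
have [g gP] := choice loc.
pose col y := if core p y then a else if y == t then b else g (p y) y.
have col_core x : core p x -> col x = a by rewrite /col => ->.
have colt : col t = b by rewrite /col (negPf nct) eqxx.
have colP y : ~~ core p y -> y <> t ->
    [/\ vertex_list p L y (col y), col y <> a & col y <> b].
  move=> ncy /eqP yt; rewrite /col (negPf ncy) (negPf yt).
  have [|ly ny] := (gP (p y)).1 y; first exact/childP.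
  by split=> // gy; apply: ny; [left|right].
have col_a x : col x = a -> core p x.
  move=> cxa; apply: contrapT => /negP ncx.
  have [xt|xt] := EM (x = t); last by have [_] := colP x ncx xt.
  by apply: ba; rewrite /= -colt -xt.
apply: (colouring_of_vertices orp (col := col)).
- move=> x _; have [cx|ncx] := boolP (core p x).
    by rewrite col_core //; move: cx; rewrite coreE => /orP[]/eqP->.
  by have [->|xt] := EM (x = t); [rewrite colt|case: (colP x ncx xt)].
- by move=> x cx; rewrite !col_core // /core (eqP cx).
move=> f autf colf.
(* Only the central edge has colour a, so f preserves it, possibly reversing it. *)
have [pfr pfs] : f s = p (f r) /\ f r = p (f s).
  have fa : edge_col p col (f r) (f s) = a.
    by rewrite colf // /edge_col ps eqxx col_core.
  have : adj (f r) (f s) by rewrite autf.2.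
  move: fa; rewrite /edge_col; case: eqP => [psr /col_a cfs _|npsr /col_a cfr].
    by rewrite -psr (eqP cfs).
  by case/orp.2 => // prs; rewrite -prs (eqP cfr).
have fcore x : core p x -> f (p x) = p (f x).
  by rewrite coreE => /orP[]/eqP->; rewrite ?pr ?ps.
(* Only t has colour b. Hence f fixes t and its parent r, which rules out the reversal of the
   central edge. *)
have ft : f t = t.
  apply: contrapT => nft.
  have [|_ _] := colP (f t) _ nft;
      first by rewrite (automorphism_core orp dpP autf fcore).
  by rewrite (automorphism_col orp dpP autf fcore colf) ?colt.
have fr : f r = r by rewrite -{1}pt (automorphism_parent orp dpP autf fcore) ft.
apply: (automorphism_fixed orp dpP autf fcore colf).
  move=> x y ncx ncy pxy cxy _.
  have [xt|xt] := EM (x = t); have [yt|yt] := EM (y = t).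
  - by rewrite xt yt.
  - by have [_ _] := colP y ncy yt; rewrite -cxy xt colt.
  - by have [_ _] := colP x ncx xt; rewrite cxy yt colt.
  apply: (gP (p x)).2; [exact/childP|exact/childP|].
  move: cxy; rewrite /col (negPf ncx) (negPf ncy) pxy.
  by move: xt yt => /eqP/negPf-> /eqP/negPf->.
by move=> x; rewrite coreE => /orP[]/eqP->; rewrite // pfr fr pr.
Qed.

Theorem theorem5 (G : sgraph) (T : Type) (Delta : set T)
    (U : Type) (Delta1 : set U) :
  is_tree G ->
  is_max_degree G Delta ->
  `I_3 #<= Delta ->
  card_pred Delta Delta1 ->
  symmetric_tree G \/ bisymmetric_tree G \/
  ((forall (W : Type) (K : set W),
      is_list_distinguishing_index G K -> K #<= Delta1) /\
   (forall (C : Type) (L : edges G -> set C),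
      (forall e : edges G, L e #= Delta1) ->
      exists c : edges G -> C,
        (forall e : edges G, L e (c e)) /\ distinguishing c)).
Proof.
move=> treeG [degG minD] D3 cardD1.
have [sym|nsym] := EM (symmetric_tree G); first by left.
have [bisym|nbisym] := EM (bisymmetric_tree G); first by right; left.
right; right; suff ldG : list_distinguishable G Delta1.
  by split=> // W K [_ Kmin]; exact: Kmin.
(* Otherwise all degrees would be at most 1, and so would their supremum. *)
have [r [s [t [rs rt ts]]]] : exists r s t : G, [/\ adj r s, adj r t & t <> s].
  apply: contrapT => nex.
  suff : `I_3 #<= `I_1 by rewrite card_le_II.
  apply: card_le_trans D3 _; apply: minD => x.
  apply: (@card_leI _ _ _ _ (fun=> 0)) => // s t xs xt _.
  by apply: contrapT => st; apply: nex; exists x, t, s.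
move=> C L LD1; pose C' : choiceType := {classic C}.
have [[infD D1D]|[k [Dk D1k]]] := cardD1.
  apply: (@infinite_degree_colouring G {classic T} Delta C' L r s t) => // e.
  exact: card_eq_trans (LD1 e) D1D.
have Lk e : L e #= `I_k by exact: card_eq_trans (LD1 e) D1k.
have degk (x : G) : nbrs x #<= `I_k.+1 by rewrite -(card_le_eqr Dk) degG.
have k_gt1 : 1 < k.
  by rewrite -ltnS -card_le_II -(card_le_eqr Dk).
have [e0 _] := adj_edge rs.
have [a0 _] : L e0 !=set0.
  apply/set0P; rewrite -(@card_eq0 _ nat) (card_eql (Lk e0)) card_eq0.
  by apply/set0P; exists 0 => /=; exact: ltnW.
have [finG|infG] := EM (finite_set [set: G]).
  by have [//|//|] :=
      @finite_tree_colouring G treeG k finG k_gt1 degk C' L a0 r Lk.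
exact: (@infinite_tree_colouring G treeG k infG k_gt1 degk r C' L a0 Lk).
Qed.
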